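(* For a connected undirected graph on $n$ vertices with integer edge weights from $\{1,2,\dots,M\}$, given the matrices $D=(d(i,j))$ and $\Lambda=(\lambda_{ij})$, the dependencies $\delta_{i*}(j)$ for all pairs $i,j$ can be computed in time $O(M n^{\omega}\,Diam(G))$.
   Context: The length of a path is the sum of its edge weights; $d(i,j)$ is the minimum length of an $i$–$j$ path, $Diam(G)=\max d(i,j)$, $\lambda_{ij}$ is the number of shortest $i$–$j$ paths ($\lambda_{ii}=1$), $\lambda_{st}(v)$ the number of shortest $s$–$t$ paths through $v$, $\delta_{st}(v)=\lambda_{st}(v)/\lambda_{st}$ and $\delta_{s*}(v)=\sum_{t:\, t\ne s,\, t\ne v}\delta_{st}(v)$. $\omega<2.376$ is the exponent of matrix multiplication. Running time is in the unit-cost arithmetic model. *)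

(* Defs.v *)
From HB Require Import structures.
From mathcomp Require Import all_boot all_order all_algebra.
From mathcomp Require Import reals exp Rstruct.
Set Implicit Arguments. Unset Strict Implicit. Unset Printing Implicit Defensive.
Import Order.TTheory GRing.Theory Num.Theory.

(* w i j = 0 means "no edge", otherwise w i j is the (integer) weight. *)
Section Graph.
Variables (n : nat) (w : 'I_n -> 'I_n -> nat).

Definition adj : rel 'I_n := fun u v => w u v != 0%N.

Definition is_walk (s t : 'I_n) (p : seq 'I_n) : bool :=
  path adj s p && (last s p == t).

Definition is_path (s t : 'I_n) (p : seq 'I_n) : bool :=
  is_walk s t p && uniq (s :: p).

Definition wlen (s : 'I_n) (p : seq 'I_n) : nat :=
  \sum_(e <- zip (s :: p) p) w e.1 e.2.

Definition is_dist (s t : 'I_n) (k : nat) : Prop :=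
  (exists2 p, is_path s t p & wlen s p = k) /\
  (forall p, is_path s t p -> (k <= wlen s p)%N).

(* all sequences of at most n-1 vertices (every path has this form) *)
Definition cand_seqs : seq (seq 'I_n) :=
  flatten [seq [seq tval x | x : k.-tuple 'I_n] | k <- iota 0 n].

Definition shortest_paths (s t : 'I_n) (d : nat) : seq (seq 'I_n) :=
  [seq p <- cand_seqs | is_path s t p && (wlen s p == d)].

End Graph.

Definition connected_graph n (w : 'I_n -> 'I_n -> nat) : Prop :=
  forall s t : 'I_n, exists p, is_path w s t p.

Definition weighted_graph n (M : nat) (w : 'I_n -> 'I_n -> nat) : Prop :=
  [/\ forall i j, w i j = w j i,
      forall i, w i i = 0%N,
      forall i j, (w i j <= M)%N &
      connected_graph w].

Definition lambda n (w : 'I_n -> 'I_n -> nat) (D : 'I_n -> 'I_n -> nat)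
  (s t : 'I_n) : nat := size (shortest_paths w s t (D s t)).

Definition lambda_through n (w : 'I_n -> 'I_n -> nat) (D : 'I_n -> 'I_n -> nat)
  (s t v : 'I_n) : nat :=
  count (fun p => v \in s :: p) (shortest_paths w s t (D s t)).

Definition dependency n (w : 'I_n -> 'I_n -> nat) (D : 'I_n -> 'I_n -> nat)
  (s v : 'I_n) : rat :=
  (\sum_(t : 'I_n | (t != s) && (t != v))
     (lambda_through w D s t v)%:R / (lambda w D s t)%:R)%R.

Definition diam n (D : 'I_n -> 'I_n -> nat) : nat := \max_(i : 'I_n) \max_(j : 'I_n) D i j.

(* Unit-cost arithmetic RAM over the rationals.                        *)
Inductive instr :=
| IConst of nat & rat
| IAdd of nat & nat & nat
| ISub of nat & nat & nat
| IMul of nat & nat & nat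
| IDiv of nat & nat & nat      (* R[r] := R[a] / R[b]  (x / 0 = 0) *)
| ILoad of nat & nat
| IStore of nat & nat
| IJlt of nat & nat & nat
| IJmp of nat.

Definition memory := nat -> rat.
Definition upd (m : memory) (r : nat) (v : rat) : memory :=
  fun x => if x == r then v else m x.
(* register address denoted by a rational (meaningful on naturals) *)
Definition addr (q : rat) : nat := `|numq q|%N.

Definition program := seq instr.
Definition config := (nat * memory)%type.

Definition step (P : program) (c : config) : option config :=
  let: (pc, m) := c in
  if (pc < size P)%N then
    Some (match nth (IJmp 0) P pc with
    | IConst r q => (pc.+1, upd m r q)
    | IAdd r a b => (pc.+1, upd m r (m a + m b)%R)
    | ISub r a b => (pc.+1, upd m r (m a - m b)%R)
    | IMul r a b => (pc.+1, upd m r (m a * m b)%R)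
    | IDiv r a b => (pc.+1, upd m r (m a / m b)%R)
    | ILoad r a => (pc.+1, upd m r (m (addr (m a))))
    | IStore a b => (pc.+1, upd m (addr (m a)) (m b))
    | IJlt a b k => (if (m a < m b)%R then k else pc.+1, m)
    | IJmp k => (k, m)
    end)
  else None.

Fixpoint run (P : program) (t : nat) (c : config) : option config :=
  match t with
  | 0 => Some c
  | t'.+1 => match step P c with Some c' => run P t' c' | None => None end
  end.

Definition halts_in (P : program) (m : memory) (t : nat) (m' : memory) : Prop :=
  exists pc, run P t (0%N, m) = Some (pc, m') /\ step P (pc, m') = None.

Definition at_offset n (F : 'I_n -> 'I_n -> rat) (k : nat) : rat :=
  match insub (k %/ n)%N, insub (k %% n)%N with
  | Some i, Some j => F i j | _, _ => 0%R end.

(* input layout for matrix multiplication: R0 = n, A at 1 + i n + j,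
   B at 1 + n^2 + i n + j; all other registers 0. Output A*B at 1 + i n + j. *)
Definition mm_input n (A B : 'M[rat]_n) : memory := fun x =>
  if x == 0%N then (n%:R)%R else
  if (x - 1 < n * n)%N then
    at_offset (fun i j => A i j) (x - 1)%N
  else if (x - 1 - n * n < n * n)%N then
    at_offset (fun i j => B i j) (x - 1 - n * n)%N
  else 0%R.

Definition matmul_in_time (tau : Rdefinitions.R) : Prop :=
  exists (c : Rdefinitions.R) (Q : program), (0 < c)%R /\
    forall n (A B : 'M[rat]_n), exists t m',
      [/\ halts_in Q (mm_input A B) t m',
          forall i j : 'I_n, m' (1 + i * n + j)%N = ((A *m B)%R) i j &
          (t%:R <= c * ((n%:R `^ tau) + 1))%R].

(* input layout for the dependency problem: R0 = n, R1 = M,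
   D at 2 + i n + j, Lambda at 2 + n^2 + i n + j, all else 0. *)
Definition dep_input n (M : nat) (D L : 'I_n -> 'I_n -> nat) : memory := fun x =>
  if x == 0%N then (n%:R)%R else
  if x == 1%N then (M%:R)%R else
  if (x - 2 < n * n)%N then
    at_offset (fun i j => ((D i j)%:R)%R) (x - 2)%N
  else if (x - 2 - n * n < n * n)%N then
    at_offset (fun i j => ((L i j)%:R)%R) (x - 2 - n * n)%N
  else 0%R.

(* Main.v *)
Require Import Defs.
From HB Require Import structures.
From mathcomp Require Import all_boot all_order all_algebra.
From mathcomp Require Import reals exp Rstruct.
From mathcomp Require Import zify ring lra.
From Stdlib Require Import FunctionalExtensionality.
Set Implicit Arguments. Unset Strict Implicit. Unset Printing Implicit Defensive.
Import Order.TTheory GRing.Theory Num.Theory.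

(** Shortest paths through v split at v, so lambda_st(v) = lambda_sv lambda_vt
    when d(s,v) + d(v,t) = d(s,t), and 0 otherwise. Hence
    delta_s*(v) = lambda_sv P_sv(0) - 1, where
    P_sv(y) = sum_t (lambda_vt / lambda_st) y^(d(s,v) + d(v,t) - d(s,t))
    is a polynomial of degree at most 2 Diam. For y > 0 the matrix (P_sv(y)) is,
    up to the factors y^d(s,v), the product of (1 / (y^d(s,t) lambda_st)) and
    (y^d(t,v) lambda_tv), so it costs one matrix multiplication. With
    N = 2 Diam + 1, the vanishing of the N-th finite difference gives
    P_sv(0) = sum_(1 <= y <= N) (-1)^(y-1) C(N,y) P_sv(y),
    i.e. O(Diam) multiplications suffice. The remaining work is
    O(Diam (n^2 + Diam)), which is absorbed because Diam <= M n and because any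
    matrix multiplication program needs n^2 steps to write its output.

    The given multiplication program may address arbitrary registers, so it is
    interpreted on a sandboxed copy of the memory whose writes are logged and
    undone after each run. *)

(** * Structured programs *)

(** Interpolation is forced by the point [y = 0]: the wanted value sits exactly where the first
    factor, with entries [1 / (y^d(s,t) lambda_st)], is singular. Consecutive integers are
    convenient points because their weights are signed binomial coefficients, each obtained from the
    previous one in constant time. Both factors, and the outer factor [y^d(s,v) lambda_sv], are read
    off the single table [y^d lambda]. Reading the second factor at [(t, v)] instead of [(v, t)] is
    legitimate because the graph is undirected. Distances and counts are defined through simple
    paths, while splitting and concatenating produce walks. Positivity of the edge weights
    reconciles the two: a walk of minimal length cannot repeat a vertex. The exponent [tau] is an
    arbitrary real number, so even [tau >= 0] has to be extracted from the existence of a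
    multiplication program. Interpretation costs only a constant factor since the interpreted
    program is fixed, and undoing a run is no dearer than the run itself, since each step logs at
    most one write. *)

Definition placed (P : program) (b : nat) (cs : seq instr) : Prop :=
  exists pre post, P = pre ++ cs ++ post /\ size pre = b.

Lemma placed_catl P b c1 c2 : placed P b (c1 ++ c2) -> placed P b c1.
Proof. by move=> [pre [post [-> <-]]]; exists pre, (c2 ++ post); rewrite -catA. Qed.

Lemma placed_catr P b c1 c2 :
  placed P b (c1 ++ c2) -> placed P (b + size c1) c2.
Proof.
move=> [pre [post [-> <-]]]; exists (pre ++ c1), post.
by rewrite size_cat !catA.
Qed.

Lemma placed_cons P b i cs : placed P b (i :: cs) ->
  [/\ (b < size P)%N, nth (IJmp 0) P b = i & placed P b.+1 cs].
Proof.
move=> h; move: (h) => [pre [post [-> <-]]]; split.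
- by rewrite !size_cat /= -addSnnS leq_addr.
- by rewrite nth_cat ltnn subnn.
- by exists (rcons pre i), post; rewrite size_rcons cat_rcons.
Qed.

Lemma run_add P t1 t2 c : run P (t1 + t2) c = obind (run P t2) (run P t1 c).
Proof.
elim: t1 c => [|t1 IH] c //=; case: (step P c) => [c'|] //=.
Qed.

Lemma run_trans P t1 t2 c c' c'' :
  run P t1 c = Some c' -> run P t2 c' = c'' -> run P (t1 + t2) c = c''.
Proof. by move=> h1 h2; rewrite run_add h1. Qed.

Definition jump (i : instr) : bool :=
  match i with IJlt _ _ _ | IJmp _ => true | _ => false end.

Definition effect (i : instr) (m : memory) : memory :=
  match i with
  | IConst r q => upd m r q
  | IAdd r a b => upd m r (m a + m b)%R
  | ISub r a b => upd m r (m a - m b)%R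
  | IMul r a b => upd m r (m a * m b)%R
  | IDiv r a b => upd m r (m a / m b)%R
  | ILoad r a => upd m r (m (addr (m a)))
  | IStore a b => upd m (addr (m a)) (m b)
  | _ => m
  end.

Inductive cmd :=
| Skip
| Op of instr
| Seq of cmd & cmd
| If of nat & nat & cmd & cmd      (* If a b c1 c2: test R[a] < R[b] *)
| While of nat & nat & cmd.

Fixpoint csize (c : cmd) : nat :=
  match c with
  | Skip => 0
  | Op _ => 1
  | Seq c1 c2 => csize c1 + csize c2
  | If _ _ c1 c2 => (csize c2 + csize c1).+2
  | While _ _ c1 => (csize c1).+3
  end.

Fixpoint compile (b : nat) (c : cmd) : seq instr :=
  match c with
  | Skip => [::]
  | Op i => [:: i]
  | Seq c1 c2 => compile b c1 ++ compile (b + csize c1) c2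
  | If x y c1 c2 =>
      IJlt x y (b.+1 + csize c2).+1 :: compile b.+1 c2 ++
      IJmp ((b.+1 + csize c2).+1 + csize c1) :: compile (b.+1 + csize c2).+1 c1
  | While x y c1 =>
      IJlt x y b.+2 :: IJmp (b.+2 + csize c1).+1 :: compile b.+2 c1 ++ [:: IJmp b]
  end.

Lemma size_compile b c : size (compile b c) = csize c.
Proof.
elim: c b => //= [c1 IH1 c2 IH2|x y c1 IH1 c2 IH2|x y c1 IH1] b.
- by rewrite size_cat IH1 IH2.
- by rewrite size_cat /= IH1 IH2 addnS.
- by rewrite size_cat /= IH1 addn1.
Qed.

(** The number counts machine steps of the compiled code exactly: a false test of [If] pays for the
    jump over the other branch, and a loop pays two jumps per iteration and two on exit. *)
Inductive exec : cmd -> memory -> nat -> memory -> Prop :=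
| ESkip m : exec Skip m 0 m
| EOp i m : ~~ jump i -> exec (Op i) m 1 (effect i m)
| ESeq c1 c2 m t1 m1 t2 m2 :
    exec c1 m t1 m1 -> exec c2 m1 t2 m2 -> exec (Seq c1 c2) m (t1 + t2) m2
| EIfT a b c1 c2 m t m' :
    (m a < m b)%R -> exec c1 m t m' -> exec (If a b c1 c2) m t.+1 m'
| EIfF a b c1 c2 m t m' :
    ~~ (m a < m b)%R -> exec c2 m t m' -> exec (If a b c1 c2) m t.+2 m'
| EWhileF a b c m : ~~ (m a < m b)%R -> exec (While a b c) m 2 m
| EWhileT a b c m t m' t' m'' :
    (m a < m b)%R -> exec c m t m' -> exec (While a b c) m' t' m'' ->
    exec (While a b c) m (t.+2 + t') m''.

Lemma step_jlt P b m x y k : (b < size P)%N -> nth (IJmp 0) P b = IJlt x y k ->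
  step P (b, m) = Some (if (m x < m y)%R then k else b.+1, m).
Proof. by move=> /= -> ->. Qed.

Lemma step_jmp P b m k : (b < size P)%N -> nth (IJmp 0) P b = IJmp k ->
  step P (b, m) = Some (k, m).
Proof. by move=> /= -> ->. Qed.

(** Jump targets are absolute, so code is compiled for a given start address. Keeping [P] and [b]
    general in the induction lets a loop re-enter the same placement. *)
Lemma compile_sound c m t m' : exec c m t m' ->
  forall P b, placed P b (compile b c) -> run P t (b, m) = Some (b + csize c, m').
Proof.
elim=> {c m t m'}.
- by move=> m P b _; rewrite /= addn0.
- move=> i m hi P b /placed_cons[hb hn _] /=; rewrite hb hn addn1.
  by case: i hi {hn}.
- move=> c1 c2 m t1 m1 t2 m2 _ IH1 _ IH2 P b /= hp.
  apply: (run_trans (IH1 _ _ (placed_catl hp))).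
  move: (placed_catr hp); rewrite size_compile => /IH2 ->.
  by rewrite addnA.
- move=> x y c1 c2 m t m' hlt _ IH P b /placed_cons[hb hn].
  move=> /placed_catr; rewrite size_compile => /placed_cons[_ _ /IH h].
  rewrite -add1n; apply: (@run_trans _ _ _ _ ((b.+1 + csize c2).+1, m)).
    by rewrite /run (step_jlt _ hb hn) hlt.
  by rewrite h /=; congr (Some (_, _)); lia.
- move=> x y c1 c2 m t m' hlt _ IH P b /placed_cons[hb hn] hp.
  move: (IH _ _ (placed_catl hp)) => h.
  move: (placed_catr hp); rewrite size_compile => /placed_cons[hb2 hn2 _].
  rewrite (_ : t.+2 = 1 + (t + 1))%N; last by lia.
  apply: (@run_trans _ _ _ _ (b.+1, m)).
    by rewrite /run (step_jlt _ hb hn) (negbTE hlt).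
  apply: (run_trans h); rewrite /run (step_jmp _ hb2 hn2) /=.
  by congr (Some (_, _)); lia.
- move=> x y c m hlt P b /placed_cons[hb hn] /placed_cons[hb2 hn2 _].
  apply: (@run_trans _ 1 1 _ (b.+1, m)).
    by rewrite /run (step_jlt _ hb hn) (negbTE hlt).
  by rewrite /run (step_jmp _ hb2 hn2) /=; congr (Some (_, _)); lia.
- move=> x y c m t m' t' m'' hlt _ IH _ IH' P b hp.
  move: (hp) => /placed_cons[hb hn] /placed_cons[hb2 hn2 hp2].
  rewrite (_ : t.+2 + t' = 1 + (t + (1 + t')))%N; last by lia.
  apply: (@run_trans _ _ _ _ (b.+2, m)).
    by rewrite /run (step_jlt _ hb hn) hlt.
  apply: (run_trans (IH _ _ (placed_catl hp2))).
  move: (placed_catr hp2); rewrite size_compile => /placed_cons[hb3 hn3 _].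
  apply: (@run_trans _ _ _ _ (b, m')).
    by rewrite /run (step_jmp _ hb3 hn3).
  exact: IH'.
Qed.

Definition wp (c : cmd) (T : nat) (Q : memory -> Prop) (m : memory) : Prop :=
  exists t m', [/\ exec c m t m', (t <= T)%N & Q m'].

Lemma wp_halts c T Q m : wp c T Q m ->
  exists t m', [/\ halts_in (compile 0 c) m t m', (t <= T)%N & Q m'].
Proof.
move=> [t [m' [he ht hq]]]; exists t, m'; split=> //.
exists (csize c); split; last by rewrite /= size_compile ltnn.
by rewrite (compile_sound he) //; exists [::], [::]; rewrite cats0.
Qed.

Lemma wp_weaken c T T' (Q Q' : memory -> Prop) m : (T <= T')%N ->
  (forall m', Q m' -> Q' m') -> wp c T Q m -> wp c T' Q' m.
Proof.
move=> hT hQ [t [m' [he ht hq]]]; exists t, m'.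
by split=> //; [exact: leq_trans hT | exact: hQ].
Qed.

Lemma wp_skip T (Q : memory -> Prop) m : Q m -> wp Skip T Q m.
Proof. by exists 0, m; split=> //; constructor. Qed.

Lemma wp_op i T (Q : memory -> Prop) m : ~~ jump i -> (0 < T)%N ->
  Q (effect i m) -> wp (Op i) T Q m.
Proof. by move=> hi hT hq; exists 1, (effect i m); split=> //; constructor. Qed.

Lemma wp_seq c1 c2 T1 T2 Q m :
  wp c1 T1 (wp c2 T2 Q) m -> wp (Seq c1 c2) (T1 + T2) Q m.
Proof.
move=> [t1 [m1 [he1 ht1 [t2 [m2 [he2 ht2 hq]]]]]].
by exists (t1 + t2), m2; split=> //; [econstructor; eauto | exact: leq_add].
Qed.

Lemma wp_if a b c1 c2 T Q m :
  (if (m a < m b)%R then wp c1 T Q m else wp c2 T Q m) -> wp (If a b c1 c2) T.+2 Q m.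
Proof.
case: ifPn => hlt [t [m' [he ht hq]]].
- exists t.+1, m'; split=> //; first by constructor.
  exact: leqW.
- by exists t.+2, m'; split=> //; apply: EIfF.
Qed.

Lemma wp_while a b c N T (I : nat -> memory -> Prop) m :
  (forall k m, (k < N)%N -> I k m -> (m a < m b)%R /\ wp c T (I k.+1) m) ->
  (forall m, I N m -> ~~ (m a < m b)%R) ->
  I 0 m -> wp (While a b c) (N * T.+2 + 2) (I N) m.
Proof.
move=> hs hN h0.
suff gen : forall j k m, (k + j = N)%N -> I k m ->
    wp (While a b c) (j * T.+2 + 2) (I N) m by apply: (gen N 0).
elim=> [|j IH] k {h0}m hk hI.
  rewrite addn0 in hk; rewrite hk in hI; exists 2, m; split=> //.
  by constructor; exact: hN.
have [hlt [t [m1 [he ht hI1]]]] := hs k m ltac:(lia) hI.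
have [t' [m2 [he2 ht2 hI2]]] := IH k.+1 m1 ltac:(lia) hI1.
exists (t.+2 + t'), m2; split=> //; first by econstructor; eauto.
by rewrite mulSn; lia.
Qed.

Record state := St { rg : nat -> rat; ar : nat -> rat; xm : memory }.

Definition reg (r : nat) : nat := 4 * r + 11.

(* Squaring commutes with taking numerators, [addr (q * q) = addr q ^ 2], also
   for non-integral [q]; hence a foreign program whose register [x] is kept at
   the physical address [x ^ 2] can use any rational as an indirect address.
   Squares are 0 or 1 mod 4, so 4 x + 2 and 4 x + 3 remain free; the physical
   registers 3 and 7 serve as scratch. *)
Definition view (m : memory) : state :=
  St (fun r => m (reg r)) (fun x => m (4 * x + 2)) (fun x => m (x * x)).

Definition setr (s : state) r v := St (upd (rg s) r v) (ar s) (xm s).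
Definition seta (s : state) x v := St (rg s) (upd (ar s) x v) (xm s).
Definition setx (s : state) x v := St (rg s) (ar s) (upd (xm s) x v).

Lemma addr_nat k : addr (k%:R)%R = k.
Proof. by rewrite /addr -[(k%:R)%R]/((k%:Z)%:~R)%R numq_int. Qed.

(** Squares of coprime integers are coprime, so a fraction in lowest terms stays in lowest terms
    when squared. *)
Lemma addr_sqr q : addr (q * q)%R = (addr q * addr q)%N.
Proof.
rewrite /addr -abszM; congr absz.
rewrite -{1 2}(divq_num_den q) mulf_div -!intrM.
rewrite coprimeq_num; last by rewrite !abszM coprimeMl !coprimeMr !coprime_num_den.
by rewrite gtr0_sg ?mulr_gt0 ?denq_gt0 // mul1r.
Qed.

Lemma neq_sqr4_2 x y : (x * x == 4 * y + 2) = false.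
Proof.
apply/negbTE/eqP => h; have := congr1 (modn^~ 4) h.
rewrite mulnC modnMDl -modnMm.
by have := ltn_pmod x (isT : 0 < 4); case: (x %% 4) => [|[|[|[|]]]].
Qed.

Lemma neq_sqr4_3 x y : (x * x == 4 * y + 3) = false.
Proof.
apply/negbTE/eqP => h; have := congr1 (modn^~ 4) h.
rewrite mulnC modnMDl -modnMm.
by have := ltn_pmod x (isT : 0 < 4); case: (x %% 4) => [|[|[|[|]]]].
Qed.

Lemma neq_sqr_reg x r : (x * x == reg r) = false.
Proof. by rewrite /reg -(neq_sqr4_3 x (r + 2)); congr (_ == _); lia. Qed.

Lemma neq_sqr_3 x : (x * x == 3) = false.
Proof. exact: (neq_sqr4_3 x 0). Qed.

Lemma neq_sqr_7 x : (x * x == 7) = false.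
Proof. exact: (neq_sqr4_3 x 1). Qed.

Lemma eq_sqr x y : (x * x == y * y) = (x == y).
Proof. by apply/eqP/eqP => [|->//]; nia. Qed.

Lemma eq_state s s' : rg s =1 rg s' -> ar s =1 ar s' -> xm s =1 xm s' -> s = s'.
Proof.
case: s s' => [r a x] [r' a' x'] /= h1 h2 h3.
by congr St; apply: functional_extensionality.
Qed.

Lemma view_scratch m t v : (t == 3) || (t == 7) -> view (upd m t v) = view m.
Proof.
move=> ht; apply: eq_state => x /=; rewrite /upd.
- by rewrite ifN // /reg; lia.
- by rewrite ifN //; lia.
- by case/orP: ht => /eqP->; rewrite ?neq_sqr_3 ?neq_sqr_7.
Qed.

Lemma view_reg m r v : view (upd m (reg r) v) = setr (view m) r v.
Proof.
apply: eq_state => x //=; rewrite /upd ?neq_sqr_reg //.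
- by rewrite (_ : (reg x == reg r) = (x == r)) // /reg; lia.
- by rewrite ifN // /reg; lia.
Qed.

Lemma view_ar m x v : view (upd m (4 * x + 2) v) = seta (view m) x v.
Proof.
apply: eq_state => y //=; rewrite /upd ?neq_sqr4_2 //.
- by rewrite ifN // /reg; lia.
- by rewrite (_ : (4 * y + 2 == 4 * x + 2) = (y == x)) //; lia.
Qed.

Lemma view_xm m x v : view (upd m (x * x) v) = setx (view m) x v.
Proof.
apply: eq_state => y //=; rewrite /upd ?eq_sqr //.
- by rewrite eq_sym neq_sqr_reg.
- by rewrite eq_sym neq_sqr4_2.
Qed.

Inductive hop :=
| HConst of nat & rat
| HAdd of nat & nat & nat
| HSub of nat & nat & nat
| HMul of nat & nat & nat
| HDiv of nat & nat & nat
| HGet of nat & nat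
| HPut of nat & nat
| XGet of nat & nat
| XPut of nat & nat.

Definition ops (cs : seq instr) : cmd := foldr (fun i c => Seq (Op i) c) Skip cs.

Definition array_address (a : nat) : seq instr :=
  [:: IConst 3 4; IMul 3 3 (reg a); IConst 7 2; IAdd 3 3 7].

Definition hcode (h : hop) : seq instr :=
  match h with
  | HConst r q => [:: IConst (reg r) q]
  | HAdd r a b => [:: IAdd (reg r) (reg a) (reg b)]
  | HSub r a b => [:: ISub (reg r) (reg a) (reg b)]
  | HMul r a b => [:: IMul (reg r) (reg a) (reg b)]
  | HDiv r a b => [:: IDiv (reg r) (reg a) (reg b)]
  | HGet r a => rcons (array_address a) (ILoad (reg r) 3)
  | HPut a b => rcons (array_address a) (IStore 3 (reg b))
  | XGet r a => [:: IMul 3 (reg a) (reg a); ILoad (reg r) 3]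
  | XPut a b => [:: IMul 3 (reg a) (reg a); IStore 3 (reg b)]
  end.

Definition hok (h : hop) (s : state) : Prop :=
  match h with
  | HGet _ a | HPut a _ => exists k, rg s a = (k%:R)%R
  | _ => True
  end.

Definition hsem (h : hop) (s : state) : state :=
  match h with
  | HConst r q => setr s r q
  | HAdd r a b => setr s r (rg s a + rg s b)%R
  | HSub r a b => setr s r (rg s a - rg s b)%R
  | HMul r a b => setr s r (rg s a * rg s b)%R
  | HDiv r a b => setr s r (rg s a / rg s b)%R
  | HGet r a => setr s r (ar s (addr (rg s a)))
  | HPut a b => seta s (addr (rg s a)) (rg s b)
  | XGet r a => setr s r (xm s (addr (rg s a)))
  | XPut a b => setx s (addr (rg s a)) (rg s b)
  end.

Lemma wp_ops cs T Q m : all (predC jump) cs -> (size cs <= T)%N ->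
  Q (foldl (fun m i => effect i m) m cs) -> wp (ops cs) T Q m.
Proof.
elim: cs T m => [|i cs IH] T m /=; first by move=> *; apply: wp_skip.
case/andP=> hi hcs; case: T => // T hT hq.
by rewrite -add1n; apply: wp_seq; apply: wp_op => //; apply: IH.
Qed.

Lemma reg_neq3 r : (reg r == 3) = false. Proof. by rewrite /reg; lia. Qed.

Lemma reg_neq7 r : (reg r == 7) = false. Proof. by rewrite /reg; lia. Qed.

Lemma foldl_array_address m a k : m (reg a) = (k%:R)%R ->
  let m' := foldl (fun m i => effect i m) m (array_address a) in
  view m' = view m /\ m' 3 = ((4 * k + 2)%:R)%R /\ forall r, m' (reg r) = m (reg r).
Proof.
move=> h /=; split; first by rewrite !view_scratch.
split; first by rewrite /upd /= reg_neq3 h natrD natrM.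
by move=> r; rewrite /upd /= reg_neq3 reg_neq7.
Qed.

(** Quantifying over all memories with a given view hides the scratch cells and all addresses
    outside the three regions. *)
Definition hwp (c : cmd) (T : nat) (Q : state -> Prop) (s : state) : Prop :=
  forall m, view m = s -> wp c T (fun m' => Q (view m')) m.

(** The uniform cost 5 is that of an array access: four instructions for the address and one for the
    transfer. It is the source of the factor 5 in all later time bounds. *)
Lemma hop_wp h (Q : state -> Prop) s :
  hok h s -> Q (hsem h s) -> hwp (ops (hcode h)) 5 Q s.
Proof.
move=> ho hq m hm; move: ho hq; rewrite -{}hm => ho hq.
apply: wp_ops.
- by case: h {ho hq}.
- by case: h {ho hq}.
case: h ho hq => [r q|r a b|r a b|r a b|r a b|r a|a b|r a|a b] /= ho hq;
  rewrite ?view_reg //.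
- have [k hk] := ho; have [hv [h3 hr]] := foldl_array_address hk.
  move: hv h3 hr => /= hv h3 hr; rewrite h3 addr_nat hv.
  have hk2 := congr1 (fun s => ar s k) hv; rewrite /= in hk2; rewrite hk2.
  by move: hq; rewrite hk addr_nat.
- have [k hk] := ho; have [hv [h3 hr]] := foldl_array_address hk.
  move: hv h3 hr => /= hv h3 hr; rewrite h3 addr_nat view_ar hv hr.
  by move: hq; rewrite hk addr_nat.
- rewrite view_scratch //; move: hq; congr (Q (setr _ _ _)).
  by rewrite /upd /= addr_sqr neq_sqr_3.
- rewrite {2}/upd /= addr_sqr view_xm view_scratch //.
  by rewrite /upd reg_neq3.
Qed.

(** * Straight-line code and loops on the sandboxed memory *)

Definition blk (hs : seq hop) : cmd :=
  foldr (fun h c => Seq (ops (hcode h)) c) Skip hs.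

Fixpoint bwp (hs : seq hop) (s : state) (Q : state -> Prop) : Prop :=
  if hs is h :: hs' then hok h s /\ bwp hs' (hsem h s) Q else Q s.

Lemma hwp_weaken c T T' (Q Q' : state -> Prop) s : (T <= T')%N ->
  (forall s', Q s' -> Q' s') -> hwp c T Q s -> hwp c T' Q' s.
Proof. by move=> hT hQ h m hm; apply: wp_weaken (h m hm) => // m'; apply: hQ. Qed.

Lemma hwp_leq c T T' Q s : (T <= T')%N -> hwp c T Q s -> hwp c T' Q s.
Proof. by move=> hT; apply: hwp_weaken. Qed.

Lemma hwp_skip T (Q : state -> Prop) s : Q s -> hwp Skip T Q s.
Proof. by move=> hq m hm; apply: wp_skip; rewrite hm. Qed.

Lemma hwp_seq c1 c2 T1 T2 Q s :
  hwp c1 T1 (hwp c2 T2 Q) s -> hwp (Seq c1 c2) (T1 + T2) Q s.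
Proof.
move=> h m hm; apply: wp_seq; apply: wp_weaken (h m hm) => // m' h'.
exact: h'.
Qed.

Lemma hwp_blk hs T Q s : (5 * size hs <= T)%N -> bwp hs s Q -> hwp (blk hs) T Q s.
Proof.
elim: hs T s => [|h hs IH] T s hT; first by move=> hq; apply: hwp_skip.
move=> [ho hq]; apply: (@hwp_weaken _ (5 + (T - 5)) _ Q) => //.
  by rewrite /= in hT; lia.
apply: hwp_seq; apply: hop_wp => //; apply: IH => //.
by rewrite /= in hT; lia.
Qed.

Lemma hwp_if a b c1 c2 T Q s :
  (if (rg s a < rg s b)%R then hwp c1 T Q s else hwp c2 T Q s) ->
  hwp (If (reg a) (reg b) c1 c2) T.+2 Q s.
Proof.
move=> h m hm; apply: wp_if; move: h; rewrite -{1 2}hm /=.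
by case: ifP => _ h; apply: h.
Qed.

Lemma hwp_while a b c N T (I : nat -> state -> Prop) s :
  (forall k s, (k < N)%N -> I k s -> (rg s a < rg s b)%R /\ hwp c T (I k.+1) s) ->
  (forall s, I N s -> ~~ (rg s a < rg s b)%R) ->
  I 0 s -> hwp (While (reg a) (reg b) c) (N * T.+2 + 2) (I N) s.
Proof.
move=> hs hN h0 m hm.
apply: (@wp_while _ _ _ N T (fun k m => I k (view m))).
- by move=> k m1 hk hI; have [h1 h2] := hs k _ hk hI; split=> //; apply: h2.
- by move=> m1 /hN.
- by rewrite hm.
Qed.

Lemma bget r a hs s Q k : rg s a = (k%:R)%R ->
  bwp hs (setr s r (ar s k)) Q -> bwp (HGet r a :: hs) s Q.
Proof. by move=> h hq; split; [exists k | rewrite /= h addr_nat]. Qed.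

Lemma bput a b hs s Q k v : rg s a = (k%:R)%R -> rg s b = v ->
  bwp hs (seta s k v) Q -> bwp (HPut a b :: hs) s Q.
Proof. by move=> h h' hq; split; [exists k | rewrite /= h addr_nat h']. Qed.

Lemma bxget r a hs s Q k : rg s a = (k%:R)%R ->
  bwp hs (setr s r (xm s k)) Q -> bwp (XGet r a :: hs) s Q.
Proof. by move=> h hq; split => //=; rewrite h addr_nat. Qed.

Lemma bxget_rat r a hs s Q q : rg s a = q ->
  bwp hs (setr s r (xm s (addr q))) Q -> bwp (XGet r a :: hs) s Q.
Proof. by move=> h hq; split => //=; rewrite h. Qed.

Lemma bxput a b hs s Q k v : rg s a = (k%:R)%R -> rg s b = v ->
  bwp hs (setx s k v) Q -> bwp (XPut a b :: hs) s Q.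
Proof. by move=> h h' hq; split => //=; rewrite h addr_nat h'. Qed.

Lemma bxput_rat a b hs s Q q v : rg s a = q -> rg s b = v ->
  bwp hs (setx s (addr q) v) Q -> bwp (XPut a b :: hs) s Q.
Proof. by move=> h h' hq; split => //=; rewrite h h'. Qed.

Lemma bconst r q hs s Q : bwp hs (setr s r q) Q -> bwp (HConst r q :: hs) s Q.
Proof. by []. Qed.

Lemma badd r a b hs s Q i j : rg s a = (i%:R)%R -> rg s b = (j%:R)%R ->
  bwp hs (setr s r ((i + j)%:R)%R) Q -> bwp (HAdd r a b :: hs) s Q.
Proof. by move=> h h' hq; split => //=; rewrite h h' -natrD. Qed.

Lemma bmul r a b hs s Q i j : rg s a = (i%:R)%R -> rg s b = (j%:R)%R ->
  bwp hs (setr s r ((i * j)%:R)%R) Q -> bwp (HMul r a b :: hs) s Q.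
Proof. by move=> h h' hq; split => //=; rewrite h h' -natrM. Qed.

Lemma bsub r a b hs s Q i j : rg s a = (i%:R)%R -> rg s b = (j%:R)%R -> (j <= i)%N ->
  bwp hs (setr s r ((i - j)%:R)%R) Q -> bwp (HSub r a b :: hs) s Q.
Proof. by move=> h h' le hq; split => //=; rewrite h h' -natrB. Qed.

Lemma badd_rat r a b hs s Q u v : rg s a = u -> rg s b = v ->
  bwp hs (setr s r (u + v)%R) Q -> bwp (HAdd r a b :: hs) s Q.
Proof. by move=> h h' hq; split => //=; rewrite h h'. Qed.

Lemma bsub_rat r a b hs s Q u v : rg s a = u -> rg s b = v ->
  bwp hs (setr s r (u - v)%R) Q -> bwp (HSub r a b :: hs) s Q.
Proof. by move=> h h' hq; split => //=; rewrite h h'. Qed.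

Lemma bmul_rat r a b hs s Q u v : rg s a = u -> rg s b = v ->
  bwp hs (setr s r (u * v)%R) Q -> bwp (HMul r a b :: hs) s Q.
Proof. by move=> h h' hq; split => //=; rewrite h h'. Qed.

Lemma bdiv_rat r a b hs s Q u v : rg s a = u -> rg s b = v ->
  bwp hs (setr s r (u / v)%R) Q -> bwp (HDiv r a b :: hs) s Q.
Proof. by move=> h h' hq; split => //=; rewrite h h'. Qed.

Lemma bnil s (Q : state -> Prop) : Q s -> bwp [::] s Q.
Proof. by []. Qed.

Definition agree (b : nat) (f g : nat -> rat) : Prop :=
  forall x, (x < b)%N -> f x = g x.

Lemma agree_upd b f g x v : (b <= x)%N -> agree b f g -> agree b (upd f x v) g.
Proof. by move=> hx h y hy; rewrite /upd ifN ?h //; lia. Qed.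

Lemma agree_trans b f g h : agree b f g -> agree b g h -> agree b f h.
Proof. by move=> h1 h2 x hx; rewrite h1 ?h2. Qed.

Lemma agree_le b b' f g : (b <= b')%N -> agree b' f g -> agree b f g.
Proof. by move=> hb h x hx; apply: h; apply: leq_trans hb. Qed.

Ltac regval :=
  rewrite /= /upd /=;
  first [ eassumption
        | match goal with H : agree _ (rg ?s) _ |- rg ?s _ = _ =>
            etransitivity; [apply: H; done | first [eassumption | reflexivity]] end
        | reflexivity ].

(** The rules for natural numbers are tried first, so that register contents stay in the form [k%:R]
    required for array addresses; the rational rules are the fallback. *)
Ltac hstep :=
  lazymatch goal with
  | |- bwp [::] _ _ => apply: bnil
  | |- bwp (HConst _ _ :: _) _ _ => apply: bconst
  | |- bwp (HAdd _ _ _ :: _) _ _ =>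
      first [ eapply badd; [regval | regval | ] | eapply badd_rat; [regval | regval | ]]
  | |- bwp (HSub _ _ _ :: _) _ _ =>
      first [ eapply bsub; [regval | regval | by lia | ]
            | eapply bsub_rat; [regval | regval | ]]
  | |- bwp (HMul _ _ _ :: _) _ _ =>
      first [ eapply bmul; [regval | regval | ] | eapply bmul_rat; [regval | regval | ]]
  | |- bwp (HDiv _ _ _ :: _) _ _ => eapply bdiv_rat; [regval | regval | ]
  | |- bwp (HGet _ _ :: _) _ _ => eapply bget; [regval | ]
  | |- bwp (HPut _ _ :: _) _ _ => eapply bput; [regval | regval | ]
  | |- bwp (XGet _ _ :: _) _ _ =>
      first [ eapply bxget; [regval | ] | eapply bxget_rat; [regval | ]]
  | |- bwp (XPut _ _ :: _) _ _ =>
      first [ eapply bxput; [regval | regval | ] | eapply bxput_rat; [regval | regval | ]]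
  | |- bwp ?hs ?s ?Q => let hs' := eval hnf in hs in progress change (bwp hs' s Q)
  end.

Lemma nat_lt_rat i j : ((i%:R : rat) < j%:R)%R = (i < j)%N.
Proof. by rewrite ltr_nat. Qed.

(* Array layout: the [nn] entries of D, those of Lambda, the accumulated results,
   the powers of the evaluation point, and finally the log. *)
Definition base_D nn := nn + 14.
Definition base_L nn := base_D nn + nn.
Definition base_acc nn := base_L nn + nn.
Definition base_pow nn := base_acc nn + nn.
Definition base_log nn Dm := base_pow nn + Dm + 1.

(* Registers 0-9 are fixed after the setup; 10 and 11 hold the evaluation point
   and its interpolation coefficient, 12 the end of the log, 13 and 14 the program
   counter and the length of the interpreted program; the others are temporaries. *)
Definition std (n Dm : nat) (r : nat -> rat) : Prop :=
  [/\ [/\ r 0 = (n%:R)%R, r 1 = (1%:R)%R, r 2 = ((base_D (n * n))%:R)%R,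
      r 3 = ((base_L (n * n))%:R)%R & r 4 = ((base_acc (n * n))%:R)%R] &
      [/\ r 5 = ((base_pow (n * n))%:R)%R, r 6 = ((n * n)%:R)%R,
      r 7 = (Dm%:R)%R, r 8 = ((base_log (n * n) Dm)%:R)%R &
      r 9 = ((Dm + Dm + 1 + 1)%:R)%R]].

Ltac bases := rewrite /base_log /base_pow /base_acc /base_L /base_D; lia.

Ltac agr := rewrite /=; repeat (apply: agree_upd; [first [done | bases] | ]);
  first [done | by move=> ? ? ].

(** The machine has no exponentiation. Tabulating [y ^ 0, ..., y ^ Dm] once per point turns each
    later power into one indirect access. *)
Definition pow_init : seq hop := [:: HPut 5 1; HConst 15 0].
Definition pow_body : seq hop :=
  [:: HAdd 16 5 15; HGet 17 16; HMul 17 17 10; HAdd 16 16 1; HPut 16 17;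
      HAdd 15 15 1].
Definition pow_phase : cmd :=
  Seq (blk pow_init) (While (reg 15) (reg 7) (blk pow_body)).

Lemma pow_phase_wp n Dm y s : std n Dm (rg s) -> rg s 10 = (y%:R)%R ->
  hwp pow_phase (10 + (Dm * 32 + 2))
    (fun s' => [/\ agree 12 (rg s') (rg s),
      agree (base_pow (n * n)) (ar s') (ar s), xm s' = xm s &
      forall j, (j <= Dm)%N -> ar s' (base_pow (n * n) + j) = ((y ^ j)%:R)%R]) s.
Proof.
move=> [[h0 h1 h2 h3 h4] [h5 h6 h7 h8 h9]] hy.
apply: hwp_seq; apply: hwp_blk => //; do! hstep.
pose I k s' := rg s' 15 = (k%:R)%R /\ [/\ agree 12 (rg s') (rg s),
      agree (base_pow (n * n)) (ar s') (ar s), xm s' = xm s &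
      forall j, (j <= k)%N -> ar s' (base_pow (n * n) + j) = ((y ^ j)%:R)%R].
apply: (@hwp_weaken _ (Dm * 32 + 2) _ (I Dm)) => //; first by move=> s' [_].
apply: hwp_while.
- move=> k s' hk [hk1 [hr ha hx hp]]; split.
    by rewrite (hr 7) // h7 hk1 nat_lt_rat.
  apply: hwp_blk => //; do! hstep; split; first by rewrite /= /upd /= addn1.
  split=> //; [agr | agr | ].
  move=> j hj; rewrite /= /upd; case: eqP => [hjk|hjk].
    rewrite hp // (_ : j = k.+1); last by lia.
    by rewrite expnSr natrM.
  by apply: hp; lia.
- by move=> s' [hk1 [hr _ _ _]]; rewrite (hr 7) // h7 hk1 nat_lt_rat ltnn.
- split=> //; split=> //=; [agr | agr | ].
  by move=> j; rewrite leqn0 => /eqP->; rewrite addn0 /upd eqxx.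
Qed.

(** * Interpreting the multiplication program *)

(* The array cells [b, ..., l - 1] contain the addresses written in the sandbox since
   it was last zero; unwinding the log restores the all-zero memory. *)
Definition logged (b l : nat) (s : state) : Prop :=
  [/\ rg s 12 = (l%:R)%R, (b <= l)%N &
      forall x, xm s x != 0%R -> exists2 j, (b <= j < l)%N & addr (ar s j) = x].

Definition log_store : seq hop := [:: HPut 12 21; HAdd 12 12 1; XPut 21 20].

Lemma bwp_log_store hs s (Q : state -> Prop) b l q v :
  logged b l s -> rg s 1 = (1%:R)%R -> rg s 21 = q -> rg s 20 = v ->
  (forall s', logged b l.+1 s' -> xm s' = upd (xm s) (addr q) v ->
     (forall r, r != 12 -> rg s' r = rg s r) -> agree l (ar s') (ar s) ->
     bwp hs s' Q) ->
  bwp (log_store ++ hs) s Q.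
Proof.
move=> [h12 hbl hlog] h1 h21 h20 hQ; rewrite /log_store /cat.
eapply bput; [eassumption | eassumption |].
eapply badd; [regval | regval |].
eapply bxput_rat; [regval | regval |].
apply: hQ => //=; last agr; last first.
  by move=> r hr; rewrite /upd (negbTE hr).
split=> /=; [by rewrite /upd /= addn1 | exact: leqW |].
move=> x; rewrite /upd; case: (x =P addr q) => [-> _|hx].
  by exists l; [lia | rewrite eqxx].
by move=> /hlog[j hj hj2]; exists j; [lia | rewrite ifN //; lia].
Qed.

Lemma logged_setr b l s r v : r != 12 -> logged b l s -> logged b l (setr s r v).
Proof. by move=> hr [h1 h2 h3]; split=> //=; rewrite /upd eq_sym (negbTE hr). Qed.

Definition inc_pc : seq hop := [:: HAdd 13 13 1].

Definition binop_code (f : nat -> nat -> nat -> hop) r a b : cmd :=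
  blk ([:: HConst 21 (a%:R)%R; XGet 20 21; HConst 21 (b%:R)%R; XGet 22 21;
           f 20 20 22; HConst 21 (r%:R)%R] ++ log_store ++ inc_pc).

Definition instr_code (i : instr) : cmd :=
  match i with
  | IConst r q => blk ([:: HConst 20 q; HConst 21 (r%:R)%R] ++ log_store ++ inc_pc)
  | IAdd r a b => binop_code HAdd r a b
  | ISub r a b => binop_code HSub r a b
  | IMul r a b => binop_code HMul r a b
  | IDiv r a b => binop_code HDiv r a b
  | ILoad r a =>
      blk ([:: HConst 21 (a%:R)%R; XGet 21 21; XGet 20 21; HConst 21 (r%:R)%R] ++
           log_store ++ inc_pc)
  | IStore a b =>
      blk ([:: HConst 21 (a%:R)%R; XGet 21 21; HConst 22 (b%:R)%R; XGet 20 22] ++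
           log_store ++ inc_pc)
  | IJlt a b k =>
      Seq (blk [:: HConst 21 (a%:R)%R; XGet 20 21; HConst 21 (b%:R)%R; XGet 22 21])
        (If (reg 20) (reg 22) (blk [:: HConst 13 (k%:R)%R]) (blk inc_pc))
  | IJmp k => blk [:: HConst 13 (k%:R)%R]
  end.

(** The interpreted program is a constant, so its instructions are expanded into code and selected
    by a chain of comparisons. Reaching position [k] means [k <= pc], so the test [pc < k + 1]
    singles out [pc = k]. *)
Fixpoint dispatch (k : nat) (Q : program) : cmd :=
  if Q is i :: Q' then
    Seq (blk [:: HConst 22 (k.+1%:R)%R])
      (If (reg 13) (reg 22) (instr_code i) (dispatch k.+1 Q'))
  else Skip.

Definition interpret (Q : program) : cmd :=
  Seq (blk [:: HConst 13 (0%:R)%R; HConst 14 ((size Q)%:R)%R])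
    (While (reg 13) (reg 14) (dispatch 0 Q)).

Section Interpreter.
Variables (Q : program) (b : nat) (r0 a0 : nat -> rat).
Hypothesis r0_1 : r0 1 = (1%:R)%R.

Definition interp_inv (l : nat) (c : config) (s : state) : Prop :=
  [/\ xm s = c.2, rg s 13 = (c.1%:R)%R, rg s 14 = ((size Q)%:R)%R,
      agree 12 (rg s) r0 & agree b (ar s) a0 /\ logged b l s].

Definition interp_post (l : nat) (c : config) (s : state) : Prop :=
  exists2 l', (l' <= l.+1)%N & interp_inv l' c s.

Lemma logged_inc_pc l pc m s s0 r v : interp_inv l (pc, m) s ->
  (forall r, r \notin [:: 20; 21; 22] -> rg s0 r = rg s r) ->
  ar s0 = ar s -> xm s0 = xm s -> rg s0 21 = r -> rg s0 20 = v ->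
  bwp (log_store ++ inc_pc) s0
    (interp_post l (pc.+1, upd m (addr r) v)).
Proof.
move=> [hx h13 h14 hr [ha [h12 hbl hlog]]] hr0 ha0 hx0 h21 h20.
rewrite [fst _]/= in h13; rewrite [snd _]/= in hx.
apply: (@bwp_log_store _ _ _ b l _ _ _ _ h21 h20).
- by split=> //; rewrite ?hr0 // hx0 ha0.
- by rewrite hr0 // hr.
move=> s' hl hx' hr' ha'.
apply: (@badd _ _ _ _ _ _ pc 1); [by rewrite hr' ?hr0 | by rewrite hr' // hr0 // hr |].
exists l.+1 => //; split=> //=.
- by rewrite hx' hx0 hx.
- by rewrite /upd /= addn1.
- by rewrite /upd /= hr' ?hr0.
- move=> x hxx; rewrite /upd ifN; last by lia.
  by rewrite hr' ?hr0 ?hr // ?inE; lia.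
split; last exact: logged_setr.
apply: agree_trans ha; rewrite -ha0; exact: agree_le ha'.
Qed.

Ltac other_regs :=
  let x := fresh "x" in let hx := fresh "hx" in
  move=> x; rewrite !inE => hx; rewrite /= /upd !ifN //; lia.

Lemma binop_code_wp f op l pc m s r x y :
  (forall s hs P u v i j k, rg s i = u -> rg s j = v ->
     bwp hs (setr s k (op u v)) P -> bwp (f k i j :: hs) s P) ->
  interp_inv l (pc, m) s ->
  hwp (binop_code f r x y) 55 (interp_post l (pc.+1, upd m r (op (m x) (m y)))) s.
Proof.
move=> hf hI; have [/= hx h13 h14 hr _] := hI.
apply: hwp_blk => //; rewrite !cat_cons cat0s.
apply: bconst; eapply bxget; [regval|]; apply: bconst; eapply bxget; [regval|].
apply: hf; [regval | regval |]; apply: bconst.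
rewrite -[in upd m r](addr_nat r).
by apply: (logged_inc_pc hI) => //=; [other_regs | rewrite /upd /= hx].
Qed.

Lemma instr_code_wp i l pc m s :
  interp_inv l (pc, m) s -> (pc < size Q)%N -> nth (IJmp 0) Q pc = i ->
  hwp (instr_code i) 55
    (fun s' => exists2 c, step Q (pc, m) = Some c & interp_post l c s') s.
Proof.
move=> hI hpc hi; have [/= hx h13 h14 hr [ha hl]] := hI.
rewrite hpc hi.
have wk c c' : hwp c' 55 (interp_post l c) s ->
    hwp c' 55 (fun s' => exists2 c1, Some c = Some c1 & interp_post l c1 s') s.
  by apply: hwp_weaken => // s' h; exists c.
case: i hi => [r q|r x y|r x y|r x y|r x y|r x|x y|x y k|k] hi; apply: wk.
- apply: hwp_blk => //; rewrite !cat_cons cat0s; do 2!apply: bconst.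
  rewrite -[in upd m r](addr_nat r).
  by apply: (logged_inc_pc hI) => //=; other_regs.
- by apply: (@binop_code_wp HAdd (fun u v => u + v)%R) hI => *; apply: badd_rat; eauto.
- by apply: (@binop_code_wp HSub (fun u v => u - v)%R) hI => *; apply: bsub_rat; eauto.
- by apply: (@binop_code_wp HMul (fun u v => u * v)%R) hI => *; apply: bmul_rat; eauto.
- by apply: (@binop_code_wp HDiv (fun u v => u / v)%R) hI => *; apply: bdiv_rat; eauto.
- apply: hwp_blk => //; rewrite !cat_cons cat0s; apply: bconst; eapply bxget; [regval|].
  eapply bxget_rat; [regval|]; apply: bconst.
  rewrite -[in upd m r](addr_nat r).
  by apply: (logged_inc_pc hI) => //=; [other_regs | rewrite /upd /= hx].
- apply: hwp_blk => //; rewrite !cat_cons cat0s; apply: bconst; eapply bxget; [regval|].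
  apply: bconst; eapply bxget; [regval|].
  by apply: (logged_inc_pc hI) => //=; [other_regs | rewrite /upd /= hx | rewrite /upd /= hx].
- apply: (@hwp_seq _ _ 20 35); apply: hwp_blk => //; do! hstep.
  apply: (@hwp_if _ _ _ _ 33).
  set c := (X in if X then hwp _ _ _ _ else _).
  have -> : c = (m x < m y)%R by rewrite /c /= /upd /= hx.
  case: (m x < m y)%R; apply: hwp_blk => //; do! hstep; exists l => //; split=> //=;
    first [agr | by rewrite /upd /= addn1].
- by apply: hwp_blk => //; do! hstep; exists l => //; split=> //=; agr.
Qed.

Lemma dispatch_wp l pc m s : interp_inv l (pc, m) s -> (pc < size Q)%N ->
  hwp (dispatch 0 Q) (7 * size Q + 55)
    (fun s' => exists2 c, step Q (pc, m) = Some c & interp_post l c s') s.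
Proof.
move=> hI hpc.
suff gen j : forall k s, (k + j = size Q)%N -> (k <= pc)%N -> interp_inv l (pc, m) s ->
    hwp (dispatch k (drop k Q)) (7 * j + 55)
    (fun s' => exists2 c, step Q (pc, m) = Some c & interp_post l c s') s.
  by have := gen (size Q) 0 s; rewrite drop0; apply.
elim: j => [|j IH] k {hI}s hk hkpc hI; first by lia.
rewrite (drop_nth (IJmp 0)); last by lia.
rewrite (_ : (7 * j.+1 + 55) = 5 + (7 * j + 55).+2)%N; last by lia.
apply: hwp_seq; apply: hwp_blk => //; hstep.
apply: hwp_if.
have hI' : interp_inv l (pc, m) (setr s 22 (k.+1%:R)%R).
  by have [hx h13 h14 hr [ha hl]] := hI; split=> //=; agr.
have [_ /= h13 _ _ _] := hI'; rewrite h13 /upd /= nat_lt_rat.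
case: ifP => hlt.
  have e : pc = k by lia.
  apply: hwp_weaken (instr_code_wp hI' hpc _) => //; first by lia.
  by rewrite e.
by apply: IH => //; lia.
Qed.

(** The log grows by at most one entry per simulated step; this later bounds the cost of unwinding
    by the running time of the program. *)
Lemma interpret_wp l s t m' : agree 12 (rg s) r0 -> agree b (ar s) a0 ->
  logged b l s -> halts_in Q (xm s) t m' ->
  hwp (interpret Q) (10 + (t * (7 * size Q + 57) + 2))
    (fun s' => [/\ xm s' = m', agree 12 (rg s') r0, agree b (ar s') a0 &
                   exists2 l', (l' <= l + t)%N & logged b l' s']) s.
Proof.
move=> hr ha hl [pc [hrun hstop]].
apply: hwp_seq; apply: hwp_blk => //; do! hstep.
pose I k s' := exists c l', [/\ run Q k (0, xm s) = Some c, (l' <= l + k)%N &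
  interp_inv l' c s'].
rewrite (_ : 7 * size Q + 57 = (7 * size Q + 55).+2)%N; last by lia.
apply: (@hwp_weaken _ (t * (7 * size Q + 55).+2 + 2) _ (I t)) => //.
  move=> s' [c [l' [hc hl' [hx _ _ hr' [ha' hlg]]]]].
  move: hc; rewrite hrun => -[e]; rewrite -e in hx.
  by split=> //; exists l'.
apply: hwp_while.
- move=> k s' hk [[pc1 m1] [l' [hc hl' hI]]].
  (* The run goes on beyond step [k < t], so a step is possible here and the program counter is in
     range. *)
  have hpc : (pc1 < size Q)%N.
    move: hrun; rewrite (_ : t = k + (t - k).-1.+1)%N; last by lia.
    by rewrite run_add hc /=; case: ifP.
  have [_ h13 h14 _ _] := hI; split; first by rewrite h13 h14 nat_lt_rat.
  apply: hwp_weaken (dispatch_wp hI hpc) => // s2 [c hs [l2 hl2 hI2]].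
  exists c, l2; split=> //; last by lia.
  by rewrite -addn1 run_add hc /= -/(step Q (pc1, m1)) hs.
- move=> s' [[pc1 m1] [l' [hc hl' [_ h13 h14 _ _]]]].
  move: hc; rewrite hrun => -[e1 _]; rewrite h13 h14 nat_lt_rat /= -e1.
  by move: hstop => /=; case: ifP.
- exists (0, xm s), l; split=> //; first by lia.
  by split=> //=; agr.
Qed.

End Interpreter.

(** * One evaluation point *)

Lemma at_offset_flat n (F : 'I_n -> 'I_n -> rat) (f : nat -> rat) k :
  (forall i j : 'I_n, F i j = f (i * n + j)) -> (k < n * n)%N -> at_offset F k = f k.
Proof.
move=> hF hk; have n0 : (0 < n)%N by case: n hk {F hF}.
rewrite /at_offset; case: insubP => [i _ hi|]; last by rewrite ltn_divLR // hk.
case: insubP => [j _ hj|]; last by rewrite ltn_mod n0.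
by rewrite hF hi hj -divn_eq.
Qed.

Definition inputs (n : nat) (d l : nat -> nat) (a : nat -> rat) : Prop :=
  forall k, (k < n * n)%N -> a (base_D (n * n) + k) = ((d k)%:R)%R /\
                             a (base_L (n * n) + k) = ((l k)%:R)%R.

Definition pw (d l : nat -> nat) (y k : nat) : nat := y ^ d k * l k.

(** Both matrices are entrywise functions of the same table, so one pass over the input loads them
    together. The entry of [mxB] at [(t, v)] stands for the one at [(v, t)], which agrees with it by
    symmetry. *)
Definition mxA n (d l : nat -> nat) (y : nat) : 'M[rat]_n :=
  (\matrix_(i, j) ((pw d l y (i * n + j))%:R)^-1)%R.
Definition mxB n (d l : nat -> nat) (y : nat) : 'M[rat]_n :=
  (\matrix_(i, j) (pw d l y (i * n + j))%:R)%R.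

Definition powers (nn Dm y : nat) (a : nat -> rat) : Prop :=
  forall j, (j <= Dm)%N -> a (base_pow nn + j) = ((y ^ j)%:R)%R.

Definition load_init : seq hop :=
  [:: HConst 18 (0%:R)%R; HAdd 12 8 18; HAdd 20 0 18; HConst 21 (0%:R)%R] ++
  log_store ++ [:: HConst 15 (0%:R)%R].
Definition load_body : seq hop :=
  [:: HAdd 16 2 15; HGet 17 16; HAdd 17 5 17; HGet 17 17; HAdd 16 3 15; HGet 16 16;
      HMul 17 17 16; HAdd 21 15 1; HDiv 20 1 17] ++ log_store ++
  [:: HAdd 21 21 6; HConst 18 (0%:R)%R; HAdd 20 17 18] ++ log_store ++
  [:: HAdd 15 15 1].
Definition load_phase : cmd :=
  Seq (blk load_init) (While (reg 15) (reg 6) (blk load_body)).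

Definition acc_body : seq hop :=
  [:: HAdd 16 2 15; HGet 17 16; HAdd 17 5 17; HGet 17 17; HAdd 16 3 15; HGet 16 16;
      HMul 17 17 16; HMul 17 17 11; HAdd 21 15 1; XGet 18 21; HMul 17 17 18;
      HAdd 16 4 15; HGet 18 16; HAdd 18 18 17; HPut 16 18; HAdd 15 15 1].
Definition acc_phase : cmd :=
  Seq (blk [:: HConst 15 (0%:R)%R]) (While (reg 15) (reg 6) (blk acc_body)).

Definition unwind_phase : cmd :=
  While (reg 8) (reg 12)
    (blk [:: HSub 12 12 1; HGet 16 12; HConst 17 (0%:R)%R; XPut 16 17]).

(** With [N] one less than register 9 and [p] the current point, the weight is multiplied by
    [- (N - p) / (p + 1)], the ratio of consecutive weights. *)
Definition next_point : seq hop :=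
  [:: HSub 16 9 1; HSub 16 16 10; HAdd 10 10 1; HMul 11 11 16; HDiv 11 11 10;
      HConst 16 (0%:R)%R; HSub 11 16 11].

Definition round (Q : program) : cmd :=
  Seq pow_phase (Seq load_phase (Seq (interpret Q)
    (Seq acc_phase (Seq unwind_phase (blk next_point))))).

Section Round.
Variables (n Dm : nat) (d l : nat -> nat).
Hypothesis hd : forall k, (k < n * n)%N -> (d k <= Dm)%N.

Lemma load_phase_wp y s : std n Dm (rg s) -> inputs n d l (ar s) ->
  powers (n * n) Dm y (ar s) -> xm s = (fun=> 0%R) ->
  hwp load_phase (40 + (n * n * 97 + 2))
    (fun s' => [/\ agree 12 (rg s') (rg s),
      agree (base_log (n * n) Dm) (ar s') (ar s),
      xm s' = mm_input (mxA n d l y) (mxB n d l y) &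
      logged (base_log (n * n) Dm) (base_log (n * n) Dm + 1 + (n * n + n * n)) s']) s.
Proof.
move=> [[h0 h1 h2 h3 h4] [h5 h6 h7 h8 h9]] hin hpow hx.
apply: hwp_seq; apply: hwp_blk => //; rewrite /load_init !cat_cons cat0s.
do 4!hstep.
apply: (@bwp_log_store _ _ _ (base_log (n * n) Dm) (base_log (n * n) Dm) (0%:R)%R (n%:R)%R).
- by split=> //=; [rewrite /upd /= addn0 | rewrite hx => x; rewrite eqxx].
- by regval.
- by regval.
- by rewrite /= /upd /= addn0.
move=> s1 hl1 hx1 hr1 ha1; do! hstep.
pose val (k x : nat) : rat := (if (x == 0)%N then n%:R else
  if (x - 1 < k)%N then ((pw d l y (x - 1))%:R)^-1 else
  if (n * n <= x - 1)%N && (x - 1 < n * n + k)%N then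
    (pw d l y (x - 1 - n * n))%:R else 0)%R.
pose I k s' := [/\ rg s' 15 = (k%:R)%R, agree 12 (rg s') (rg s),
      agree (base_log (n * n) Dm) (ar s') (ar s), xm s' = val k &
      logged (base_log (n * n) Dm) (base_log (n * n) Dm + 1 + (k + k)) s'].
apply: (@hwp_weaken _ (n * n * 95.+2 + 2) _ (I (n * n))) => //.
  move=> s' [_ hr ha hv hl]; split=> //; rewrite hv.
  apply: functional_extensionality => x; rewrite /val /mm_input.
  case: eqP => // _; case: ltnP => h1x.
    symmetry; apply: (@at_offset_flat _ _ (fun k => ((pw d l y k)%:R)^-1)%R) => // i j.
    by rewrite mxE.
  rewrite (_ : (x - 1 < n * n + n * n) = (x - 1 - n * n < n * n))%N /=; last by lia.
  case: ltnP => // h2x.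
  symmetry; apply: (@at_offset_flat _ _ (fun k => (pw d l y k)%:R)%R) => // i j.
  by rewrite mxE.
apply: hwp_while.
- move=> k s' hk [hk1 hr ha hv hl]; split.
    by rewrite (hr 6) // h6 hk1 nat_lt_rat.
  have [hdk hlk] := hin k hk.
  apply: hwp_blk => //; rewrite /load_body !cat_cons cat0s.
  do 2!hstep.
  eapply badd; [regval | rewrite /= /upd /= ha; [exact: hdk | bases] |].
  do 3!hstep.
  eapply bmul.
  + rewrite /= /upd /= ha; last by have := hd hk; bases.
    by apply: hpow; apply: hd.
  + by rewrite /= /upd /= ha; [exact: hlk | bases].
  do 2!hstep.
  apply: bwp_log_store.
  + by do !apply: logged_setr => //; exact: hl.
  + by regval.
  + by regval.
  + by regval.
  move=> s2 hl2 hx2 hr2 ha2.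
  eapply badd; [rewrite hr2 //; regval | rewrite hr2 //; regval |].
  apply: bconst.
  eapply badd; [rewrite /= /upd /= hr2 //; regval | regval |].
  apply: bwp_log_store.
  + by do !apply: logged_setr => //; exact: hl2.
  + by rewrite /= /upd /= hr2 //; regval.
  + by regval.
  + by regval.
  move=> s3 hl3 hx3 hr3 ha3.
  eapply badd; [rewrite hr3 // /= /upd /= hr2 //; regval |
                rewrite hr3 // /= /upd /= hr2 //; regval |].
  hstep; split.
  + by rewrite /= /upd /= addn1.
  + move=> x hx12; rewrite /= /upd ifN; last by lia.
    rewrite hr3 /= /upd ?ifN; try lia.
    rewrite hr2 /= /upd ?ifN; try lia.
    exact: hr.
  + move=> x hxx; rewrite /= ha3 /= ?ha2 /= ?ha //; lia.
  + rewrite /= hx3 /= hx2 /= hv !addr_nat.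
    apply: functional_extensionality => x; rewrite /upd /val /pw.
    rewrite !natrM /= mul1r addn0.
    case: (x =P k + 1 + n * n) => [->|h1x].
      have -> : (k + 1 + n * n == 0)%N = false by lia.
      have -> : (k + 1 + n * n - 1 < k.+1)%N = false by lia.
      have -> : (n * n <= k + 1 + n * n - 1 < n * n + k.+1)%N by lia.
      have -> : (k + 1 + n * n - 1 - n * n)%N = k by lia.
      by rewrite natrM.
    case: (x =P k + 1) => [->|h2x]; first by rewrite addnK ltnSn addn1.
    case: (x =P 0) => // h3x.
    rewrite (_ : (x - 1 < k.+1) = (x - 1 < k))%N; last by lia.
    by rewrite (_ : (x - 1 < n * n + k.+1) = (x - 1 < n * n + k))%N; last by lia.
  + have -> : (base_log (n * n) Dm + 1 + (k.+1 + k.+1))%N =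
      (base_log (n * n) Dm + 1 + (k + k)).+2 by lia.
    exact: logged_setr.
- by move=> s' [hk1 hr _ _ _]; rewrite (hr 6) // h6 hk1 nat_lt_rat ltnn.
- split=> //=.
  + move=> x hx12; rewrite /= /upd ifN; last by lia.
    rewrite hr1 /= /upd ?ifN; try lia.
    by [].
  + rewrite hx1 /= hx; apply: functional_extensionality => x.
    rewrite /upd /val addr_nat; case: eqP => // hx0.
    by rewrite ifN ?ifN //; lia.
  + rewrite !addn0 addn1; exact: logged_setr.
Qed.

(** The log is still needed for the undo, so the frame keeps register 12 as well ([agree 13]) and
    protects the array on both sides of the accumulators. *)
Lemma acc_phase_wp y c s : std n Dm (rg s) -> inputs n d l (ar s) ->
  powers (n * n) Dm y (ar s) -> rg s 11 = c ->
  hwp acc_phase (5 + (n * n * 82 + 2))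
    (fun s' => [/\ agree 13 (rg s') (rg s),
      forall k, (k < n * n)%N -> ar s' (base_acc (n * n) + k) =
        (ar s (base_acc (n * n) + k) + (pw d l y k)%:R * c * xm s (k + 1))%R,
      forall x, (x < base_acc (n * n)) || (base_pow (n * n) <= x) -> ar s' x = ar s x &
      xm s' = xm s]) s.
Proof.
move=> [[h0 h1 h2 h3 h4] [h5 h6 h7 h8 h9]] hin hpow hc.
apply: hwp_seq; apply: hwp_blk => //; do! hstep.
pose val k j := (if (j < k)%N then
    ar s (base_acc (n * n) + j) + (pw d l y j)%:R * c * xm s (j + 1) else
    ar s (base_acc (n * n) + j))%R.
pose I k s' := rg s' 15 = (k%:R)%R /\ [/\ agree 13 (rg s') (rg s),
      forall j, (j < n * n)%N -> ar s' (base_acc (n * n) + j) = val k j,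
      forall x, (x < base_acc (n * n)) || (base_pow (n * n) <= x) -> ar s' x = ar s x &
      xm s' = xm s].
apply: (@hwp_weaken _ (n * n * 80.+2 + 2) _ (I (n * n))) => //.
  by move=> s' [_ [hr hv ho hx]]; split=> // k hk; rewrite hv // /val hk.
apply: hwp_while.
- move=> k s' hk [hk1 [hr hv ho hx]]; split.
    by rewrite (hr 6) // h6 hk1 nat_lt_rat.
  have [hdk hlk] := hin k hk; have hdm := hd hk.
  apply: hwp_blk => //; do 3!hstep.
  eapply badd; [regval | rewrite /= /upd /= ho; [exact: hdk | bases] |].
  do 3!hstep.
  eapply bmul.
  + rewrite /= /upd /= ho; last by bases.
    by apply: hpow; apply: hd.
  + by rewrite /= /upd /= ho; [exact: hlk | bases].
  do! hstep; split; first by rewrite /= /upd /= addn1.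
  split=> //; first by agr.
  + move=> j hj; rewrite /= /upd eqn_add2l; case: (j =P k) => [->|hjk].
      by rewrite hv // hx /val ltnn ltnSn.
    rewrite hv // /val; congr (if _ then _ else _); lia.
  + by move=> x hxx; rewrite /= /upd ifN ?ho //; move: hxx; bases.
- by move=> s' [hk1 [hr _ _ _]]; rewrite (hr 6) // h6 hk1 nat_lt_rat ltnn.
- by split=> //; split=> //=; agr.
Qed.

Lemma unwind_phase_wp b e s : logged b e s -> rg s 8 = (b%:R)%R -> rg s 1 = (1%:R)%R ->
  hwp unwind_phase ((e - b) * 22 + 2)
    (fun s' => [/\ agree 12 (rg s') (rg s), ar s' = ar s & xm s' = (fun=> 0%R)]) s.
Proof.
move=> hlog h8 h1.
pose I k s' := [/\ agree 12 (rg s') (rg s), ar s' = ar s & logged b (e - k) s'].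
have [_ hbe _] := hlog.
apply: (@hwp_weaken _ ((e - b) * 20.+2 + 2) _ (I (e - b))) => //.
  move=> s' [hr ha [_ _ h]]; split=> //; apply: functional_extensionality => x.
  by apply/eqP/negPn/negP => /h[j]; lia.
apply: hwp_while.
- move=> k s' hk [hr ha [h12 hb hl]]; split.
    by rewrite (hr 8) // h8 h12 nat_lt_rat; lia.
  apply: hwp_blk => //; do! hstep; split=> //; first by agr.
  split; rewrite /= /upd /=; [by congr (_%:R)%R; lia | by lia |].
  move=> x; case: (x =P _) => [|hx]; first by rewrite eqxx.
  move=> /hl[j hj hjx]; exists j => //.
  have : j != e - k - 1 by apply/eqP => hje; apply: hx; rewrite -hjx hje.
  by lia.
- by move=> s' [hr _ [h12 _ _]]; rewrite (hr 8) // h8 h12 nat_lt_rat; lia.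
- by split=> //; rewrite subn0.
Qed.

(** The weight of the evaluation point [y + 1]; the shift comes from counting rounds from 0 while
    the points start at 1. *)
Definition coef (N y : nat) : rat := ((-1) ^+ y * 'C(N, y.+1)%:R)%R.

(** From [(k + 1) C(N, k + 1) = (N - k) C(N, k)] at [k = y + 1]. *)
Lemma coefS N y : (y < N)%N ->
  coef N y.+1 = (0 - coef N y * (N - y.+1)%:R / (y.+2)%:R)%R.
Proof.
move=> hy; rewrite /coef exprS sub0r mulN1r mulNr -!mulrA; congr (- (_ * _))%R.
rewrite mulrA; apply: (canRL (mulfK _)); first by rewrite pnatr_eq0.
by rewrite -!natrM mulnC mul_bin_left mulnC.
Qed.

Definition mx_flat (A : 'M[rat]_n) (k : nat) : rat := at_offset (fun i j => A i j) k.

Lemma round_wp Q tq y s :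
  (forall A B : 'M[rat]_n, exists t m', [/\ halts_in Q (mm_input A B) t m',
     forall i j : 'I_n, m' (1 + i * n + j)%N = (A *m B)%R i j & (t <= tq)%N]) ->
  (y < Dm + Dm + 1)%N ->
  std n Dm (rg s) -> inputs n d l (ar s) -> xm s = (fun=> 0%R) ->
  rg s 10 = (y.+1%:R)%R -> rg s 11 = coef (Dm + Dm + 1) y ->
  hwp (round Q) (Dm * 32 + n * n * 250 + tq * (7 * size Q + 100) + 200)
    (fun s' => [/\ agree 10 (rg s') (rg s), inputs n d l (ar s'), xm s' = (fun=> 0%R),
      rg s' 10 = (y.+2%:R)%R /\ rg s' 11 = coef (Dm + Dm + 1) y.+1 &
      forall k, (k < n * n)%N -> ar s' (base_acc (n * n) + k) =
        (ar s (base_acc (n * n) + k) + coef (Dm + Dm + 1) y *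
          ((pw d l y.+1 k)%:R * mx_flat (mxA n d l y.+1 *m mxB n d l y.+1) k))%R]) s.
Proof.
move=> hQ hy hstd hin hx h10 h11.
have [t [m' [hrun hout htq]]] := hQ (mxA n d l y.+1) (mxB n d l y.+1).
have [[h0 h1 h2 h3 h4] [h5 h6 h7 h8 h9]] := hstd.
have std_agree s' : agree 12 (rg s') (rg s) -> std n Dm (rg s').
  by move=> h; split; split; rewrite h.
have in_agree a' : agree (base_acc (n * n)) a' (ar s) -> inputs n d l a'.
  move=> h k hk; have [hk1 hk2] := hin k hk.
  by rewrite !h //; bases.
set T1 := 10 + (Dm * 32 + 2); set T2 := 40 + (n * n * 97 + 2).
set T3 := 10 + (t * (7 * size Q + 57) + 2); set T4 := 5 + (n * n * 82 + 2).
(* The log holds one entry for the size, two per matrix position and at most one per simulated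
   step. *)
set T5 := (1 + (n * n + n * n) + t) * 22 + 2.
apply: (@hwp_leq _ (T1 + (T2 + (T3 + (T4 + (T5 + 35)))))).
  rewrite /T1 /T2 /T3 /T4 /T5.
  have : (t * (7 * size Q + 79) <= tq * (7 * size Q + 79))%N by rewrite leq_mul2r htq orbT.
  by rewrite !mulnDr; lia.
apply: hwp_seq; apply: hwp_weaken (pow_phase_wp hstd h10) => //.
move=> s1 [hr1 ha1 hx1 hp1].
have hin1 : inputs n d l (ar s1) by apply: in_agree; apply: agree_le ha1; bases.
apply: hwp_seq.
apply: hwp_weaken (load_phase_wp (std_agree _ hr1) hin1 hp1 _) => //; last by rewrite hx1.
move=> s2 [hr2 ha2 hx2 hl2].
have hr2s := agree_trans hr2 hr1.
have h21 : rg s2 1 = (1%:R)%R by rewrite hr2s.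
apply: hwp_seq.
apply: hwp_weaken (interpret_wp (a0 := ar s1) (r0 := rg s2) h21 _ ha2 hl2 _) => //;
  first [by rewrite /T3 | by rewrite hx2; exact: hrun | idtac].
move=> s3 [hx3 hr3 ha3 [l' hl' hl3]].
have hr3s := agree_trans hr3 hr2s.
have hin3 : inputs n d l (ar s3).
  apply: in_agree; apply: agree_trans (agree_le _ ha3) (agree_le _ ha1); bases.
have hp3 : powers (n * n) Dm y.+1 (ar s3).
  by move=> j hj; rewrite ha3 ?hp1 //; bases.
apply: hwp_seq.
apply: hwp_weaken (acc_phase_wp (c := coef (Dm + Dm + 1) y) (std_agree _ hr3s) hin3 hp3 _) => //;
  first [by rewrite /T4 | by rewrite hr3s | idtac].
move=> s4 [hr4 hacc4 ho4 hx4].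
have hr4s : agree 12 (rg s4) (rg s).
  by apply: agree_trans hr3s; apply: agree_le hr4.
have hl4 : logged (base_log (n * n) Dm) l' s4.
  have [hl12 hlb hlx] := hl3; split=> //; first by rewrite hr4.
  move=> x; rewrite hx4 => /hlx[j hj hjx]; exists j => //.
  by rewrite ho4 //; move: hj; bases.
apply: hwp_seq.
apply: hwp_weaken (unwind_phase_wp hl4 _ _) => //; try by rewrite hr4s.
  by rewrite /T5; have := hl'; lia.
move=> s5 [hr5 ha5 hx5].
have hr5s := agree_trans hr5 hr4s.
have c10 : rg s5 10 = (y.+1%:R)%R by rewrite hr5s.
have c11 : rg s5 11 = coef (Dm + Dm + 1) y by rewrite hr5s.
apply: hwp_blk => //; do! hstep; split.
- by apply: agree_trans (agree_le (isT : 10 <= 12)%N hr5s); agr.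
- rewrite /= ha5; apply: in_agree => x hxx.
  rewrite ho4 ?hxx // ha3; last by move: hxx; bases.
  by rewrite ha1 //; move: hxx; bases.
- by [].
- by split; rewrite /= /upd /= ?coefS // ?addnK (addn1 y.+1).
- move=> k hk; rewrite /= ha5 hacc4 // ha3; last by bases.
  rewrite ha1; last by bases.
  rewrite hx3 [(_ * coef _ _)%R]mulrC -mulrA.
  congr (_ + _ * (_ * _))%R; rewrite /mx_flat.
  rewrite (@at_offset_flat _ _ (fun k => m' (k + 1))) // => i j.
  by rewrite -hout; congr m'; lia.
Qed.

End Round.

(** * The whole computation *)

Definition setup_regs : seq hop :=
  [:: HConst 1 (1%:R)%R; HMul 6 0 0; HConst 16 (14%:R)%R; HAdd 2 6 16; HAdd 3 2 6;
      HAdd 4 3 6; HAdd 5 4 6; HConst 16 (0%:R)%R; HPut 2 16; HConst 7 (0%:R)%R;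
      HConst 15 (0%:R)%R; HConst 18 (0%:R)%R; HConst 16 (3%:R)%R; HAdd 17 0 0;
      HAdd 17 17 16].
Definition setup_phase : cmd :=
  Seq (blk setup_regs)
    (While (reg 15) (reg 17) (blk [:: XPut 15 18; HAdd 15 15 1])).

(** The diameter is not part of the input and is found by scanning [D]. The same pass sets the
    accumulators to -1, which offsets the term [t = v] of the sum over all [t]. *)
Definition max_body : cmd :=
  Seq (blk [:: HAdd 16 2 15; HGet 17 16; HAdd 16 4 15; HPut 16 19; HAdd 15 15 1])
    (If (reg 7) (reg 17) (blk [:: HAdd 7 17 18]) Skip).
Definition max_phase : cmd :=
  Seq (blk [:: HConst 15 (0%:R)%R; HConst 19 (-1)%R; HConst 18 (0%:R)%R])
    (While (reg 15) (reg 6) max_body).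

(** Register 11 receives [N = 2 Diam + 1], which is [coef N 0], before register 9 is raised to
    [N + 1], the exclusive bound on the points. *)
Definition start_regs : seq hop :=
  [:: HAdd 8 5 7; HAdd 8 8 1; HAdd 9 7 7; HAdd 9 9 1; HConst 16 (0%:R)%R;
      HAdd 11 9 16; HAdd 9 9 1; HConst 10 (1%:R)%R].

Definition compute (Q : program) : cmd :=
  Seq setup_phase (Seq max_phase
    (Seq (blk start_regs) (While (reg 10) (reg 9) (round Q)))).

Section Compute.
Variables (n : nat) (d l : nat -> nat).
Let nn := n * n.

Definition std7 (r : nat -> rat) : Prop :=
  [/\ r 0 = (n%:R)%R, r 1 = (1%:R)%R, r 2 = ((base_D nn)%:R)%R &
  [/\ r 3 = ((base_L nn)%:R)%R, r 4 = ((base_acc nn)%:R)%R,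
      r 5 = ((base_pow nn)%:R)%R & r 6 = (nn%:R)%R]].

Definition maxd (k : nat) : nat := \max_(j < k) d j.

Lemma setup_phase_wp s : rg s 0 = (n%:R)%R ->
  (forall k, (2 * n + 2 < k)%N -> xm s k = 0%R) ->
  hwp setup_phase (75 + ((2 * n + 3) * 12 + 2))
    (fun s' => [/\ std7 (rg s') /\ rg s' 7 = (0%:R)%R, ar s' (base_D nn) = 0%R,
       forall x, x != base_D nn -> ar s' x = ar s x & xm s' = (fun=> 0%R)]) s.
Proof.
move=> h0 hx.
apply: hwp_seq; apply: hwp_blk => //; do! hstep.
rewrite -/nn.
set s1 := setr _ _ _.
have h18 : rg s1 18 = 0%R by regval.
have h1 : rg s1 1 = (1%:R)%R by regval.
have h17 : rg s1 17 = ((n + n + 3)%:R)%R by regval.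
pose I k s' := [/\ rg s' 15 = (k%:R)%R, (forall x, x != 15 -> rg s' x = rg s1 x),
  ar s' = ar s1 & forall x, (x < k)%N || (2 * n + 2 < x)%N -> xm s' x = 0%R].
apply: (@hwp_weaken _ ((2 * n + 3) * 12 + 2) _ (I (2 * n + 3))) => //.
  move=> s' [_ hr ha hx']; split.
  - by split; [split; [| | | split] | ]; rewrite hr // /s1 /= /upd.
  - by rewrite ha /= /upd eqxx.
  - by move=> x hxx; rewrite ha /= /upd (negbTE hxx).
  - by apply: functional_extensionality => x; apply: hx'; lia.
apply: hwp_while.
- move=> k s' hk [hk1 hr ha hx']; split.
    by rewrite (hr 17) // h17 hk1 nat_lt_rat; lia.
  apply: hwp_blk => //.
  apply: (@bxput _ _ _ _ _ k 0%R) => //; first by rewrite hr.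
  apply: (@badd _ _ _ _ _ _ k 1) => //; first by rewrite [LHS]hr.
  split => //; first by rewrite [LHS]/= /upd /= addn1.
  + by move=> x hxx; rewrite -hr // [LHS]/= /upd (negbTE hxx).
  + by move=> x hxx; rewrite [LHS]/= /upd; case: eqP => // hxk; apply: hx'; lia.
- by move=> s' [hk1 hr _ _]; rewrite (hr 17) // h17 hk1 nat_lt_rat; lia.
- by split=> // x hxx; rewrite /= hx //; lia.
Qed.

Lemma max_phase_wp s : std7 (rg s) -> rg s 7 = (0%:R)%R ->
  (forall k, (k < nn)%N -> ar s (base_D nn + k) = ((d k)%:R)%R) ->
  hwp max_phase (15 + (nn * 34 + 2))
    (fun s' => [/\ std7 (rg s') /\ rg s' 7 = ((maxd nn)%:R)%R,
       agree (base_acc nn) (ar s') (ar s),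
       forall k, (k < nn)%N -> ar s' (base_acc nn + k) = (-1)%R & xm s' = xm s]) s.
Proof.
move=> [h0 h1 h2 [h3 h4 h5 h6]] h7 hd.
apply: hwp_seq; apply: hwp_blk => //; do! hstep.
pose I k s' := [/\ agree 7 (rg s') (rg s) /\ rg s' 15 = (k%:R)%R,
  rg s' 18 = (0%:R)%R /\ rg s' 19 = (-1)%R, rg s' 7 = ((maxd k)%:R)%R,
  agree (base_acc nn) (ar s') (ar s) /\ xm s' = xm s &
  forall j, (j < k)%N -> ar s' (base_acc nn + j) = (-1)%R].
apply: (@hwp_weaken _ (nn * 34 + 2) _ (I nn)) => //.
  move=> s' [[hr _] _ hm [ha hx] hacc]; split=> //.
  by split=> //; split; [| | | split]; rewrite hr.
apply: (@hwp_while _ _ _ nn 32).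
- move=> k s' hk [[hr h15] [h18 h19] hm [ha hx] hacc]; split.
    by rewrite (hr 6) // h6 h15 nat_lt_rat.
  apply: (@hwp_seq _ _ 25 7); apply: hwp_blk => //; do! hstep.
  have hdk : ar s' (base_D nn + k) = ((d k)%:R)%R by rewrite ha ?hd //; bases.
  apply: (@hwp_if _ _ _ _ 5).
  set c := (X in if X then hwp _ _ _ _ else _).
  have -> : c = (maxd k < d k)%N by rewrite /c /= /upd /= hm hdk nat_lt_rat.
  have maxS : maxd k.+1 = maxn (maxd k) (d k) by rewrite /maxd big_ord_recr.
  have haccS j : (j < k.+1)%N ->
      upd (ar s') (base_acc nn + k) (-1)%R (base_acc nn + j) = (-1)%R.
    by move=> hj; rewrite /upd eqn_add2l; case: eqP => // hjk; apply: hacc; lia.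
  case: ltnP => hlt.
  + apply: hwp_blk => //.
    apply: (@badd _ _ _ _ _ _ (d k) 0); [by rewrite /= /upd /= hdk | by rewrite /= /upd /= h18 |].
    split=> //.
    * by split; [agr | rewrite /= /upd /= addn1].
    * by rewrite /= /upd /= addn0 maxS; congr (_%:R)%R; lia.
    * by split=> //; agr.
  + apply: hwp_skip; split=> //.
    * by split; [agr | rewrite /= /upd /= addn1].
    * by rewrite /= /upd /= hm maxS; congr (_%:R)%R; lia.
    * by split=> //; agr.
- by move=> s' [[hr h15] _ _ _ _]; rewrite (hr 6) // h6 h15 nat_lt_rat ltnn.
- by split=> //; [split=> //; agr | rewrite /= /upd /= h7 /maxd big_ord0].
Qed.

(** The number [N] of rounds done varies while the order of the weights is fixed, so that this
    serves as the loop invariant. *)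
Definition acc_value (N k : nat) : rat :=
  (\sum_(y < N) coef (maxd nn + maxd nn + 1) y *
    ((pw d l y.+1 k)%:R * mx_flat (mxA n d l y.+1 *m mxB n d l y.+1) k) - 1)%R.

Lemma compute_wp Q tq s :
  (forall A B : 'M[rat]_n, exists t m', [/\ halts_in Q (mm_input A B) t m',
     forall i j : 'I_n, m' (1 + i * n + j)%N = (A *m B)%R i j & (t <= tq)%N]) ->
  rg s 0 = (n%:R)%R ->
  (forall k, (k < nn)%N -> k != 0 -> ar s (base_D nn + k) = ((d k)%:R)%R) ->
  d 0 = 0 ->
  (forall k, (k < nn)%N -> ar s (base_L nn + k) = ((l k)%:R)%R) ->
  (forall k, (2 * n + 2 < k)%N -> xm s k = 0%R) ->
  hwp (compute Q) (nn * 34 + n * 24 + 200 + (maxd nn + maxd nn + 1) *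
      (maxd nn * 32 + nn * 250 + tq * (7 * size Q + 100) + 202))
    (fun s' => std7 (rg s') /\
       forall k, (k < nn)%N ->
         ar s' (base_acc nn + k) = acc_value (maxd nn + maxd nn + 1) k) s.
Proof.
move=> hQ h0 hD hd0 hL hx.
set R := maxd nn * 32 + nn * 250 + tq * (7 * size Q + 100) + 200.
set T1 := 75 + ((2 * n + 3) * 12 + 2); set T2 := 15 + (nn * 34 + 2).
apply: (@hwp_leq _ (T1 + (T2 + (40 + ((maxd nn + maxd nn + 1) * R.+2 + 2))))).
  rewrite /T1 /T2 (_ : _ + 202 = R.+2); last by rewrite /R; lia.
  by move: (_ * R.+2) => X; lia.
apply: hwp_seq; apply: hwp_weaken (setup_phase_wp h0 hx) => //.
move=> s1 [[hs1 h71] ha1 ho1 hx1].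
have hD1 k : (k < nn)%N -> ar s1 (base_D nn + k) = ((d k)%:R)%R.
  move=> hk; case: (k =P 0) => [->|/eqP hk0]; first by rewrite addn0 ha1 hd0.
  by rewrite ho1 ?hD //; bases.
have hL1 k : (k < nn)%N -> ar s1 (base_L nn + k) = ((l k)%:R)%R.
  by move=> hk; rewrite ho1 ?hL //; move: hk; bases.
apply: hwp_seq; apply: hwp_weaken (max_phase_wp hs1 h71 hD1) => //.
move=> s2 [[[h02 h12 h22 [h32 h42 h52 h62]] h72] ha2 hacc2 hx2].
apply: (@hwp_seq _ _ 40); apply: hwp_blk => //; do! hstep.
set s3 := setr _ _ _.
have hs3 : std n (maxd nn) (rg s3) by split; split; regval.
pose I k s' := [/\ agree 10 (rg s') (rg s3), inputs n d l (ar s'), xm s' = (fun=> 0%R),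
  rg s' 10 = (k.+1%:R)%R /\ rg s' 11 = coef (maxd nn + maxd nn + 1) k &
  forall j, (j < nn)%N -> ar s' (base_acc nn + j) = acc_value k j].
apply: (@hwp_weaken _ ((maxd nn + maxd nn + 1) * R.+2 + 2) _
  (I (maxd nn + maxd nn + 1))) => //.
  move=> s' [hr _ _ _ hacc]; split=> //.
  have [[g0 g1 g2 g3 g4] [g5 g6 g7 g8 g9]] := hs3.
  by split; [| | | split]; rewrite hr.
apply: hwp_while.
- move=> k s' hk [hr hin hxs [h10 h11] hacc]; split.
    have [_ [_ _ _ _ g9]] := hs3.
    by rewrite (hr 9) // g9 h10 nat_lt_rat; lia.
  have hstd : std n (maxd nn) (rg s').
    have [[g0 g1 g2 g3 g4] [g5 g6 g7 g8 g9]] := hs3.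
    by split; split; rewrite hr.
  have hmax j : (j < n * n)%N -> (d j <= maxd nn)%N.
    by move=> hj; exact: (leq_bigmax (Ordinal hj)).
  apply: hwp_weaken (round_wp hmax hQ hk hstd hin hxs h10 h11) => //.
  move=> s4 [hr4 hin4 hx4 [h104 h114] hacc4]; split=> //.
  + exact: agree_trans hr4 hr.
  + move=> j hj; rewrite hacc4 // hacc // /acc_value big_ord_recr /=.
    by rewrite addrAC.
- move=> s' [hr _ _ [h10 _] _]; have [_ [_ _ _ _ g9]] := hs3.
  by rewrite (hr 9) // g9 h10 nat_lt_rat; lia.
- split=> //=.
  + move=> k hk; split; rewrite ha2; try by bases.
      exact: hD1.
    exact: hL1.
  + by rewrite hx2.
  + by split; rewrite /upd //= /coef expr0 mul1r bin1 addn0.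
  + by move=> j hj; rewrite hacc2 // /acc_value big_ord0 sub0r.
Qed.

End Compute.

(** * Moving the input and the output *)

(** The machine address of array cell [b + k] under [view]. *)
Definition phys (b k : nat) : nat := 4 * (b + k) + 2.

Definition save_reg (k : nat) : seq instr := [:: IStore 1 k; IAdd 1 1 2].

(* The input covers all low registers for large [n]. Registers 0-11 are therefore
   saved by unrolled code before they are used; this loses registers 1 and 2, that
   is [M] and [D 0 0], of which the former is not needed and the latter is 0. *)
Definition prologue : cmd :=
  Seq (ops [:: IMul 1 0 0; IConst 2 (12%:R)%R; IAdd 1 1 2; IConst 2 (4%:R)%R;
               IMul 1 1 2; IConst 2 (2%:R)%R; IAdd 1 1 2; IConst 2 (4%:R)%R])
  (Seq (ops (flatten [seq save_reg k | k <- iota 0 12]))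
  (Seq (ops [:: IConst 6 (1%:R)%R; IMul 4 0 0; IAdd 4 4 4; IConst 5 (2%:R)%R;
                IAdd 4 4 5; IConst 3 (12%:R)%R])
  (Seq (While 3 4 (ops [:: ILoad 5 3; IStore 1 5; IAdd 3 3 6; IAdd 1 1 2]))
       (ops [:: IConst (reg 0) 0%R; IAdd (reg 0) (reg 0) 0])))).

Section Prologue.
Variables (n : nat) (inp : memory).
Hypothesis inp0 : inp 0 = (n%:R)%R.
Hypothesis inp_out : forall x, (n * n + n * n + 2 <= x)%N -> inp x = 0%R.
(** Copies start at address [4 (n^2 + 12) + 2], beyond both the input and the first 12 registers, so
    copying never overwrites unread input. Since [D] begins at input word 2, this makes [base_D]
    equal to [n^2 + 14]. *)
Let b := n * n + 12.

(** Addresses below [e], other than 0, may have been reused as working registers: [e] is 0 while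
    only registers 1 and 2 are in use, and 7 during the copying loop. *)
Definition saved (e j : nat) (m : memory) : Prop :=
  [/\ m 0 = (n%:R)%R, m 1 = ((phys b j)%:R)%R, m 2 = (4%:R)%R,
      forall k, (k < j)%N -> k \notin [:: 1; 2] -> m (phys b k) = inp k &
      forall x, x \notin [:: 1; 2] -> (x == 0) || (e <= x)%N ->
        (forall k, x != phys b k) -> m x = inp x].

Lemma phys_inj c k k' : (phys c k == phys c k') = (k == k').
Proof. by rewrite /phys; lia. Qed.

Lemma saved_step e j m a : saved e j m ->
  (j \notin [:: 1; 2] -> m a = inp j) ->
  saved e j.+1 (effect (IAdd 1 1 2) (effect (IStore 1 a) m)).
Proof.
move=> [h0 h1 h2 hs hu] ha.
rewrite /= h1 addr_nat; split; rewrite /upd /=.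
- by rewrite ifN //; rewrite /phys /b; lia.
- rewrite ifN ?ifN ?h1 ?h2 -?natrD; first by congr (_%:R)%R; rewrite /phys; lia.
  + by rewrite /phys /b; lia.
  + by rewrite /phys /b; lia.
- by rewrite ifN //; rewrite /phys /b; lia.
- move=> k hk hk12; rewrite ifN; last by rewrite /phys /b; lia.
  rewrite phys_inj; case: eqP => [e1|hkj]; first by rewrite ha -?e1.
  by apply: hs => //; lia.
- move=> x hx12 hx hp; rewrite ifN ?ifN ?hu //.
  by move: hx12; rewrite !inE; lia.
Qed.

Lemma save_regs_wp m : saved 0 0 m ->
  wp (ops (flatten [seq save_reg k | k <- iota 0 12])) 24 (saved 0 12) m.
Proof.
move=> h; apply: wp_ops => //.
suff gen r j m1 : (j + r = 12)%N -> saved 0 j m1 ->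
    saved 0 12 (foldl (fun m i => effect i m) m1 (flatten [seq save_reg k | k <- iota j r])).
  exact: (gen 12 0).
elim: r j m1 => [|r IH] j m1; first by rewrite addn0 => ->.
move=> hj hI.
change (saved 0 12 (foldl (fun m i => effect i m)
  (effect (IAdd 1 1 2) (effect (IStore 1 j) m1)) (flatten [seq save_reg k | k <- iota j.+1 r]))).
apply: IH; first by lia.
apply: saved_step => //.
move=> hj12; have [_ _ _ _ hu] := hI; apply: hu => //; first by rewrite orbT.
by move=> k; rewrite /phys /b; lia.
Qed.

Lemma prologue_wp m : m =1 inp ->
  wp prologue (42 + (n * n * 12 + 4))
    (fun m' => [/\ rg (view m') 0 = (n%:R)%R,
       forall k, (2 < k < n * n + n * n + 2)%N -> ar (view m') (b + k) = inp k &
       forall k, (2 * n + 2 < k)%N -> xm (view m') k = 0%R]) m.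
Proof.
move=> hm.
apply: (@wp_weaken _ (8 + (24 + (6 + (((n * n + n * n + 2 - 12) * 6 + 2) + 2))))
  _ _ _ _ _ (fun _ h => h)).
  by lia.
apply: wp_seq; apply: wp_ops => //.
set m1 := foldl _ _ _.
have hm1 : saved 0 0 m1.
  split; rewrite /m1 /= /upd /= ?hm ?inp0 //.
  - by rewrite -!natrM -!natrD -!natrM -!natrD; congr (_%:R)%R; rewrite /phys /b; lia.
  - by move=> x; rewrite !inE => hx _ _; rewrite !ifN ?hm //; lia.
apply: wp_seq; apply: wp_weaken (save_regs_wp hm1) => // m2 [h0 h1 h2 hs hu].
apply: wp_seq; apply: wp_ops => //.
set m3 := foldl _ _ _.
pose I k m := [/\ saved 7 (12 + k) m, m 3 = ((12 + k)%:R)%R,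
  m 4 = ((n * n + n * n + 2)%:R)%R & m 6 = (1%:R)%R].
have hm3 : I 0 m3.
  split; [split | | |]; rewrite /m3 /= /upd /= ?h0 ?h1 ?h2 //.
  - move=> k hk hk12; rewrite !ifN ?hs //; by rewrite /phys /b; lia.
  - move=> x hx12 hx hp; rewrite !ifN ?hu //; by lia.
  - by rewrite -natrM -natrD -natrD.
apply: wp_seq.
apply: wp_weaken (@wp_while 3 4 _ (n * n + n * n + 2 - 12) 4 I m3 _ _ hm3) => //.
- move=> m4 [[g0 g1 g2 gs gu] _ _ _].
  apply: wp_ops => //; rewrite /foldl /effect; split.
  + by rewrite /view /= /upd /= g0 add0r.
  + move=> k hk; rewrite /= /upd !ifN; try by rewrite /reg /b; lia.
    by apply: gs; rewrite ?inE; lia.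
  (* For [k > 2 n + 2] the square lies beyond the input and is not the address of any copy, so it
     still holds its initial 0. *)
  + move=> k hk; rewrite /= /upd !neq_sqr_reg gu.
    * by apply: inp_out; nia.
    * by rewrite !inE; nia.
    * by nia.
    * by move=> j; rewrite /phys neq_sqr4_2.
- move=> k m4 hk [hsv h3 h4 h6]; split; first by rewrite h3 h4 nat_lt_rat; lia.
  apply: wp_ops => //.
  set m5 := effect (ILoad 5 3) m4.
  have e5 : m5 =1 upd m4 5 (m4 (12 + k)).
    by move=> x; rewrite /m5 /= h3 addr_nat.
  have hsv5 : saved 7 (12 + k) m5.
    have [g0 g1 g2 gs gu] := hsv.
    split; rewrite ?e5 /upd //=.
    - by move=> j hj hj12; rewrite e5 /upd ifN ?gs //; rewrite /phys /b; lia.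
    - by move=> x hx12 hx hp; rewrite e5 /upd ifN ?gu //; lia.
  have g5 : m5 5 = inp (12 + k).
    have [g0 g1 g2 gs gu] := hsv; rewrite e5 /upd /=; apply: gu => //.
    by move=> j; rewrite /phys /b; lia.
  have h := @saved_step 7 (12 + k) m5 5 hsv5 (fun _ => g5).
  have [_ e1 _ _ _] := hsv5.
  rewrite (_ : foldl _ _ _ = effect (IAdd 1 1 2) (effect (IAdd 3 3 6) (effect (IStore 1 5) m5))) //.
  set m6 := effect (IStore 1 5) m5 in h *.
  have h36 : [/\ m6 3 = ((12 + k)%:R)%R, m6 4 = ((n * n + n * n + 2)%:R)%R & m6 6 = (1%:R)%R].
    rewrite /m6 /= e1 addr_nat /upd !ifN ?e5 //; by rewrite /phys /b; lia.
  have [h63 h64 h66] := h36.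
  (* The loop advances its counter between the store and the pointer increment; commuting the two
     updates exposes the state described by [saved_step]. *)
  have e7 : effect (IAdd 1 1 2) (effect (IAdd 3 3 6) m6) =1
            upd (effect (IAdd 1 1 2) m6) 3 ((12 + k.+1)%:R)%R.
    move=> x; rewrite /= /upd h63 h66 /=.
    case: (x =P 1) => [->|h1x] //; case: (x =P 3) => // _.
    by rewrite -natrD; congr (_%:R)%R; lia.
  have [g0 g1' g2 gs gu] := h.
  split; rewrite ?e7 /= /upd //=.
  split; rewrite ?e7 /upd //=.
  + move=> j hj hj12; rewrite -(gs j hj hj12) /= /upd.
    by rewrite !ifN //; rewrite /phys /b; lia.
  + move=> x hx12 hx hp; rewrite -(gu x hx12 hx hp) /= /upd.
    by case: (x =P 1) => // h1x; rewrite ifN //; lia.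
- move=> m4 [[_ _ _ _ _] h3 h4 _]; rewrite h3 h4 nat_lt_rat; lia.
Qed.

End Prologue.

Definition restore (k : nat) : seq instr := [:: ILoad (k + 2) 0; IAdd 0 0 1].

(** The output occupies addresses from 2 on, which clash with the registers driving the copy, the
    highest being [reg 6 = 35]. The loop therefore copies only results 40 onwards, to addresses from
    42; unrolled code using just registers 0 and 1 then fills 2 to 41. The offset 160 is [4 * 40],
    and the sources start at [12 nn + 58], above every target. *)
Definition epilogue : cmd :=
  Seq (ops [:: IConst 1 (4%:R)%R; IMul 0 (reg 4) 1; IConst 3 (2%:R)%R; IAdd 0 0 3;
               IConst 7 (160%:R)%R; IAdd 3 0 7; IConst 5 (42%:R)%R; IConst 7 (2%:R)%R;
               IAdd 6 (reg 6) 7])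
  (Seq (While 5 6 (ops [:: ILoad 7 3; IStore 5 7; IAdd 3 3 1; IAdd 5 5 (reg 1)]))
       (ops (flatten [seq restore k | k <- iota 0 40]))).

Section Epilogue.
Variables (nn : nat) (v : nat -> rat).
Let b := base_acc nn.

Definition sources (m : memory) : Prop :=
  [/\ m 1 = (4%:R)%R & forall k, (k < nn)%N -> m (phys b k) = v k].

Definition restored (j : nat) (m : memory) : Prop :=
  [/\ sources m, m 0 = ((phys b j)%:R)%R &
      forall k, (k < nn)%N -> (k < j)%N || (40 <= k)%N -> m (k + 2) = v k].

Lemma restore_regs_wp m : restored 0 m ->
  wp (ops (flatten [seq restore k | k <- iota 0 40])) 80 (restored 40) m.
Proof.
move=> h; apply: wp_ops => //.
suff gen r j m1 : (j + r = 40)%N -> restored j m1 ->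
    restored 40 (foldl (fun m i => effect i m) m1 (flatten [seq restore k | k <- iota j r])).
  exact: (gen 40 0).
elim: r j m1 => [|r IH] j m1; first by rewrite addn0 => ->.
move=> hj [[h1 hs] h0 hr].
change (restored 40 (foldl (fun m i => effect i m)
  (effect (IAdd 0 0 1) (effect (ILoad (j + 2) 0) m1))
  (flatten [seq restore k | k <- iota j.+1 r]))).
apply: IH; first by lia.
rewrite /= h0 addr_nat /upd; split; first split.
- by rewrite /= ifN //; lia.
- by move=> k hk; rewrite !ifN ?hs // /phys /b; bases.
- rewrite /= ifN ?ifN ?h1 ?h0; try by lia.
  by rewrite -natrD; congr (_%:R)%R; rewrite /phys; lia.
- move=> k hk hkj; rewrite ifN; last by lia.
  rewrite eqn_add2r; case: eqP => [e|hne]; first by rewrite -e hs.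
  by apply: hr => //; lia.
Qed.

Lemma epilogue_wp m : rg (view m) 1 = (1%:R)%R -> rg (view m) 4 = (b%:R)%R ->
  rg (view m) 6 = (nn%:R)%R -> (forall k, (k < nn)%N -> ar (view m) (b + k) = v k) ->
  wp epilogue (100 + nn * 6) (fun m' => forall k, (k < nn)%N -> m' (k + 2) = v k) m.
Proof.
rewrite /= => h1 h4 h6 hs.
apply: (@wp_weaken _ (9 + ((((nn + 2 - 42) * 6 + 2) + 80))) _ _ _ _ _ (fun _ h => h)).
  by lia.
apply: wp_seq; apply: wp_ops => //.
set m1 := foldl _ _ _.
pose I j m := [/\ sources m, m 0 = ((phys b 0)%:R)%R,
  m 3 = ((phys b (40 + j))%:R)%R /\ m 5 = ((42 + j)%:R)%R,
  m 6 = ((nn + 2)%:R)%R /\ m (reg 1) = (1%:R)%R &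
  forall k, (40 <= k < 40 + j)%N -> m (k + 2) = v k].
have hm1 : I 0 m1.
  split; [split | | split | split | ]; rewrite /m1 /= /upd /= ?h4 ?h6 ?h1 //.
  - by move=> k hk; rewrite !ifN ?hs //; rewrite /phys /b; bases.
  - by rewrite -natrM -natrD; congr (_%:R)%R; rewrite /phys; lia.
  - by rewrite -natrM -!natrD; congr (_%:R)%R; rewrite /phys; lia.
  - by rewrite -natrD.
  - by move=> k; lia.
apply: wp_seq.
apply: wp_weaken (@wp_while 5 6 _ (nn + 2 - 42) 4 I m1 _ _ hm1) => //.
- move=> m2 [hs2 h0 _ _ hk2].
  apply: wp_weaken (restore_regs_wp _) => //.
    by move=> m' [_ _ hr] k hk; apply: hr => //; lia.
  by split=> // k hk hkj; apply: hk2; lia.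
- move=> k m2 hk [[g1 gs] g0 [g3 g5] [g6 gr1] gk].
  split; first by rewrite g5 g6 nat_lt_rat; lia.
  apply: wp_ops => //.
  have hsrc : m2 (phys b (40 + k)) = v (40 + k) by apply: gs; lia.
  rewrite /foldl /effect.
  have e3 x : upd m2 7 (m2 (addr (m2 3))) x = upd m2 7 (v (40 + k)) x.
    by rewrite g3 addr_nat hsrc.
  rewrite !e3 [upd m2 7 (v (40 + k)) 5]/upd /= g5 addr_nat.
  split; [split | | split | split | ]; rewrite /upd /= ?g3 ?addr_nat ?hsrc ?g1 ?g0 ?g6 ?gr1 ?g5 //.
  + by move=> j hj; rewrite !ifN ?gs //; rewrite /phys /b; bases.
  + by rewrite -natrD; congr (_%:R)%R; rewrite /phys; lia.
  + by rewrite -natrD; congr (_%:R)%R; lia.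
  + move=> j hj; rewrite [if j + 2 == 5 then _ else _]ifN; last by lia.
    rewrite [if j + 2 == 3 then _ else _]ifN; last by lia.
    case: (j =P 40 + k) => [->|hne]; first by rewrite ifT //; lia.
    by rewrite !ifN ?gk //; lia.
- by move=> m2 [_ _ [_ g5] [g6 _] _]; rewrite g5 g6 nat_lt_rat; lia.
Qed.
End Epilogue.

(** * Counting shortest paths *)

Section Paths.
Variables (n : nat) (w : 'I_n -> 'I_n -> nat).

Lemma wlen_nil s : wlen w s [::] = 0.
Proof. by rewrite /wlen big_nil. Qed.

Lemma wlen_cons s x p : wlen w s (x :: p) = w s x + wlen w x p.
Proof. by rewrite /wlen /= big_cons. Qed.

Lemma wlen_cat s p q : wlen w s (p ++ q) = wlen w s p + wlen w (last s p) q.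
Proof.
elim: p s => [|x p IH] s /=; first by rewrite wlen_nil.
by rewrite !wlen_cons IH addnA.
Qed.

Lemma is_walk_cons s t x p : is_walk w s t (x :: p) = adj w s x && is_walk w x t p.
Proof. by rewrite /is_walk /= andbA. Qed.

Lemma is_walk_cat s t v p q : is_walk w s v p -> is_walk w v t q ->
  is_walk w s t (p ++ q).
Proof.
by rewrite /is_walk cat_path last_cat => /andP[-> /eqP->].
Qed.

Lemma mem_cand_seqs p : (p \in cand_seqs n) = (size p < n).
Proof.
apply/flatten_mapP/idP => [[k]|hp].
  by rewrite mem_iota => hk /mapP[x _ ->]; rewrite size_tuple; lia.
exists (size p); first by rewrite mem_iota.
by apply/mapP; exists (in_tuple p); rewrite ?mem_enum.
Qed.

Lemma uniq_cand_seqs : uniq (cand_seqs n).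
Proof.
rewrite /cand_seqs; move: (iota 0 n) (iota_uniq 0 n) => s.
elim: s => //= k s IH /andP[hk hs]; rewrite cat_uniq IH // andbT.
rewrite map_inj_uniq ?enum_uniq /=; last exact: val_inj.
apply/hasPn => p /flatten_mapP[j hj /mapP[x _ ->]].
apply/negP => /mapP[y _ e]; case/negP: hk.
by have := congr1 size e; rewrite !size_tuple => <-.
Qed.

Lemma size_path_lt s t p : is_path w s t p -> size p < n.
Proof.
move=> /andP[_ hu]; have := card_uniqP hu => /= <-.
by rewrite -[n in _ <= n]card_ord; apply: max_card.
Qed.

Lemma mem_shortest_paths s t k p :
  (p \in shortest_paths w s t k) = is_path w s t p && (wlen w s p == k).
Proof.
rewrite mem_filter mem_cand_seqs; case h: (is_path w s t p) => //=.
by rewrite (size_path_lt h) andbT.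
Qed.

Lemma uniq_shortest_paths s t k : uniq (shortest_paths w s t k).
Proof. exact: filter_uniq uniq_cand_seqs. Qed.

(** Cutting at an occurrence of [s] handles the case where prepending the edge from [s] to [x] would
    close a cycle. *)
Lemma walk_suffix s x t q : is_walk w x t q -> s \in x :: q ->
  exists q', [/\ is_walk w s t q', wlen w s q' <= wlen w x q &
     uniq (x :: q) -> uniq (s :: q')].
Proof.
move=> hq; rewrite inE => /orP[/eqP->|hs]; first by exists q.
case/splitPr: hs hq => p1 p2 /andP[]; rewrite cat_path last_cat.
rewrite [path _ _ (s :: p2)]/= [last _ (s :: p2)]/=.
move=> /and3P[_ _ hp] hl.
exists p2; split; first by rewrite /is_walk hp.
  by rewrite wlen_cat wlen_cons addnA leq_addl.
by rewrite -cat_cons cat_uniq => /and3P[].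
Qed.

Variable D : 'I_n -> 'I_n -> nat.
Hypothesis hD : forall i j, is_dist w i j (D i j).

Lemma dist_path s t : exists2 p, is_path w s t p & wlen w s p = D s t.
Proof. by have [] := hD s t. Qed.

Lemma dist_le_path s t p : is_path w s t p -> D s t <= wlen w s p.
Proof. by have [_] := hD s t; apply. Qed.

Lemma distxx s : D s s = 0.
Proof.
have := @dist_le_path s s [::]; rewrite wlen_nil leqn0 => h; apply/eqP/h.
by rewrite /is_path /is_walk /= eqxx.
Qed.

Lemma dist_gt0 i j : i != j -> 0 < D i j.
Proof.
move=> hij; have [[|x p] hp <-] := dist_path i j.
  by move: hp hij => /andP[/andP[_ /eqP /= ->]]; rewrite eqxx.
by move: hp => /andP[]; rewrite is_walk_cons wlen_cons /adj => /andP[h _] _; lia.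
Qed.

Lemma dist_edge s x t : adj w s x -> D s t <= w s x + D x t.
Proof.
move=> hsx; have [q /andP[hq hu] <-] := dist_path x t.
have [hs|hs] := boolP (s \in x :: q).
  have [q' [h1 h2 h3]] := walk_suffix hq hs.
  apply: leq_trans (leq_trans h2 (leq_addl _ _)).
  by apply: dist_le_path; rewrite /is_path h1 h3.
rewrite -wlen_cons; apply: dist_le_path.
by rewrite /is_path cons_uniq hs hu /is_walk /= hsx; move: hq => /andP[-> ->].
Qed.

(** Extends minimality from simple paths to walks, edge by edge through [dist_edge]; concatenated
    paths can then be compared with distances. *)
Lemma dist_le_walk s t p : is_walk w s t p -> D s t <= wlen w s p.
Proof.
elim: p s => [|x p IH] s.
  by rewrite /is_walk /= => /eqP->; rewrite distxx.
rewrite is_walk_cons wlen_cons => /andP[/dist_edge h /IH h2].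
by apply: leq_trans (h t) _; rewrite leq_add2l.
Qed.

Lemma dist_triangle s v t : D s t <= D s v + D v t.
Proof.
have [p /andP[hp _] <-] := dist_path s v; have [q /andP[hq _] <-] := dist_path v t.
have hl : last s p = v by move: hp => /andP[_ /eqP].
by rewrite -[in wlen w v q]hl -wlen_cat; apply: dist_le_walk; apply: is_walk_cat hq.
Qed.

(** Edges have positive weight, so returning to [s] after leaving it would leave a strictly shorter
    walk to [t]. *)
Lemma shortest_walk_is_path s t p : is_walk w s t p -> wlen w s p = D s t ->
  is_path w s t p.
Proof.
move=> hw hl; rewrite /is_path hw; elim: p s hw hl => [//|x p IH] s.
rewrite is_walk_cons wlen_cons => /andP[hsx hp] hl.
have h1 := dist_edge t hsx; have h2 := dist_le_walk hp.
rewrite cons_uniq [uniq _]IH //; last by lia.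
rewrite !andbT; apply/negP => hs.
have [q' [h3 h4 _]] := walk_suffix hp hs.
by have := dist_le_walk h3; move: hsx; rewrite /adj; lia.
Qed.

Lemma mem_shortest s t p :
  (p \in shortest_paths w s t (D s t)) = is_walk w s t p && (wlen w s p == D s t).
Proof.
rewrite mem_shortest_paths; apply/andP/andP => -[h1 h2]; split=> //.
  by case/andP: h1.
by apply: shortest_walk_is_path (eqP h2).
Qed.

Lemma lambda_gt0 s t : 0 < lambda w D s t.
Proof.
have [p hp hl] := dist_path s t.
rewrite /lambda; case e: shortest_paths => //.
have : p \in shortest_paths w s t (D s t) by rewrite mem_shortest_paths hp hl /=.
by rewrite e.
Qed.

(** Concatenation is a bijection from pairs of shortest paths onto the shortest paths through [v].
    Both halves of a shortest path are shortest, since neither is below its distance and the total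
    is exact. *)
Lemma lambda_through_mul s t v :
  lambda_through w D s t v =
    if D s v + D v t == D s t then lambda w D s v * lambda w D v t else 0.
Proof.
rewrite /lambda_through /lambda; case: ifP => hd; last first.
  apply/eqP; rewrite -leqn0 leqNgt -has_count; apply/hasPn => p.
  rewrite mem_shortest => /andP[hp /eqP hl]; apply/negP => hv; case/negP: (negbT hd).
  case/splitPl: hv hp hl => p1 p2 hp1 hp hl.
  have {}hp : is_walk w s v p1 && is_walk w v t p2.
    by move: hp; rewrite /is_walk cat_path last_cat hp1 eqxx andbT andbA.
  case/andP: hp => /dist_le_walk h1 /dist_le_walk h2.
  rewrite eqn_leq dist_triangle andbT -hl wlen_cat hp1.
  exact: leq_add.
have cat_shortest p q : p \in shortest_paths w s v (D s v) ->
    q \in shortest_paths w v t (D v t) -> p ++ q \in shortest_paths w s t (D s t).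
  rewrite !mem_shortest => /andP[hp /eqP lp] /andP[hq /eqP lq].
  have hl : last s p = v by case/andP: hp => _ /eqP.
  by rewrite (is_walk_cat hp hq) wlen_cat hl lp lq.
(* A shortest path is simple, so [v] occurs once and its index tells where the concatenation splits;
   this gives injectivity. *)
have index_cat p q : p \in shortest_paths w s v (D s v) ->
    q \in shortest_paths w v t (D v t) -> index v (s :: p ++ q) = size p.
  move=> hp hq; have := cat_shortest p q hp hq.
  move: hp; rewrite mem_shortest mem_shortest_paths => /andP[/andP[_ /eqP hl] _].
  move=> /andP[/andP[_ hu] _].
  rewrite -[in index v]hl (last_nth s) -[nth _ _ _](_ : nth s (s :: p ++ q) (size p) = _).
    by rewrite index_uniq //= size_cat ltnS leq_addr.
  by rewrite -cat_cons nth_cat /= ltnSn.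
rewrite -size_filter -(size_allpairs cat); apply: perm_size; apply: uniq_perm.
- by rewrite filter_uniq // uniq_shortest_paths.
- apply: allpairs_uniq; [exact: uniq_shortest_paths.. |].
  move=> x1 x2 /allpairsP[[p q] [/= hp hq ->]] /allpairsP[[p' q'] [/= hp' hq' ->]] /= e.
  have hs : size p = size p' by rewrite -(index_cat p q) // e index_cat.
  by move/eqP: e; rewrite eqseq_cat // => /andP[/eqP-> /eqP->].
move=> p; rewrite mem_filter; apply/andP/allpairsP.
  move=> [hv]; rewrite mem_shortest => /andP[hp /eqP hl].
  case/splitPl: hv hp hl => p1 p2 hp1 hp hl.
  have {}hp : is_walk w s v p1 && is_walk w v t p2.
    by move: hp; rewrite /is_walk cat_path last_cat hp1 eqxx andbT andbA.
  case/andP: hp => w1 w2; exists (p1, p2); rewrite /= !mem_shortest w1 w2.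
  have h1 := dist_le_walk w1; have h2 := dist_le_walk w2.
  move: hl; rewrite wlen_cat hp1 -(eqP hd) => hl.
  by split=> //; lia.
move=> [[p1 p2] [/= h1 h2 ->]]; split; last exact: cat_shortest.
move: h1; rewrite mem_shortest => /andP[/andP[_ /eqP <-] _].
by rewrite -cat_cons mem_cat mem_last.
Qed.

End Paths.

Section Symmetry.
Variables (n : nat) (w : 'I_n -> 'I_n -> nat) (D : 'I_n -> 'I_n -> nat).
Hypothesis hw : forall i j, w i j = w j i.
Hypothesis hD : forall i j, is_dist w i j (D i j).

(** A path is stored without its first vertex, so its reversal drops the old endpoint and ends with
    [s]. *)
Definition reverse (s : 'I_n) (p : seq 'I_n) : seq 'I_n := rev (belast s p).

Lemma reverse_cons s x p : reverse s (x :: p) = rcons (reverse x p) s.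
Proof. by rewrite /reverse /= rev_cons. Qed.

Lemma last_reverse s p : last (last s p) (reverse s p) = s.
Proof. by case: p => [|x p] //=; rewrite reverse_cons last_rcons. Qed.

Lemma reverseK s p : reverse (last s p) (reverse s p) = p.
Proof.
elim: p s => [|x p IH] s //=.
rewrite reverse_cons {1}/reverse belast_rcons lastI rev_rcons last_reverse.
by rewrite -/(reverse _ _) IH.
Qed.

Lemma walk_reverse s t p : is_walk w s t p ->
  is_walk w t s (reverse s p) /\ wlen w t (reverse s p) = wlen w s p.
Proof.
elim: p s => [|x p IH] s.
  by rewrite /is_walk /= => /eqP->; rewrite eqxx /wlen !big_nil.
rewrite is_walk_cons => /andP[hsx hp]; have [h1 h2] := IH x hp.
have hl : last t (reverse x p) = x by case/andP: h1 => _ /eqP.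
rewrite reverse_cons -cats1 wlen_cat hl h2 !wlen_cons wlen_nil addn0 addnC (hw x).
split=> //; apply: is_walk_cat h1 _.
by rewrite /is_walk /= eqxx /adj hw andbT -/(adj w s x) hsx.
Qed.

Lemma dist_sym s t : D s t = D t s.
Proof.
suff h i j : D i j <= D j i by apply/eqP; rewrite eqn_leq !h.
have [p /andP[hp _] <-] := dist_path hD j i.
by have [h1 <-] := walk_reverse hp; apply: dist_le_walk h1.
Qed.

Lemma lambda_sym s t : lambda w D s t = lambda w D t s.
Proof.
suff h i j : lambda w D i j <= lambda w D j i by apply/eqP; rewrite eqn_leq !h.
rewrite /lambda -(size_map (reverse i)); apply: uniq_leq_size.
  rewrite map_inj_in_uniq ?uniq_shortest_paths // => p q.
  rewrite !mem_shortest // => /andP[/andP[_ /eqP hp] _] /andP[/andP[_ /eqP hq] _] e.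
  by rewrite -(reverseK i p) -(reverseK i q) hp hq e.
move=> q /mapP[p]; rewrite !mem_shortest // => /andP[hp /eqP hl] ->.
by have [-> ->] := walk_reverse hp; rewrite hl dist_sym eqxx.
Qed.

End Symmetry.

(** * Bounds on the diameter *)

Lemma leq_diam n (D : 'I_n -> 'I_n -> nat) i j : D i j <= diam D.
Proof.
apply: leq_trans (@leq_bigmax _ (fun i => \max_(j < n) D i j) i).
exact: (@leq_bigmax _ (D i) j).
Qed.

Lemma wlen_bound n M (w : 'I_n -> 'I_n -> nat) s p :
  (forall i j, w i j <= M) -> wlen w s p <= M * size p.
Proof.
move=> hM; elim: p s => [|x p IH] s; first by rewrite wlen_nil.
by rewrite wlen_cons mulnS leq_add.
Qed.

Lemma diam_bound n M (w : 'I_n -> 'I_n -> nat) D : weighted_graph M w ->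
  (forall i j, is_dist w i j (D i j)) -> diam D <= M * n.
Proof.
move=> [_ _ hM _] hD; apply/bigmax_leqP => i _; apply/bigmax_leqP => j _.
have [p hp <-] := dist_path hD i j.
apply: leq_trans (wlen_bound _ _ hM) _; rewrite leq_mul2l.
by rewrite (ltnW (size_path_lt hp)) orbT.
Qed.

Lemma diam_gt0 n M (w : 'I_n -> 'I_n -> nat) D : weighted_graph M w ->
  (forall i j, is_dist w i j (D i j)) -> 1 < n -> 0 < diam D.
Proof.
move=> [_ _ _ _] hD hn.
pose i := Ordinal (ltnW hn); pose j := Ordinal hn.
by apply: leq_trans (leq_diam D i j); apply: dist_gt0 hD _ _ _.
Qed.

(** For [e = 0] this is [(1 - 1)^(N+1)], with [0 ^+ 0 = 1]. Otherwise the factor [y] is absorbed by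
    [(y + 1) C(N + 1, y + 1) = (N + 1) C(N, y)], and expanding [(y + 1)^e] leaves sums of order [N]
    with smaller exponents. *)
Lemma finite_difference_exp (N e : nat) : e < N ->
  (\sum_(y < N.+1) (-1) ^+ y * 'C(N, y)%:R * y%:R ^+ e = 0 :> rat)%R.
Proof.
elim: N e => // N IH [_|e].
  have := exprDn (1 : rat)%R (-1)%R N.+1; rewrite subrr expr0n /= => e.
  rewrite [RHS]e; apply: eq_bigr => y _.
  by rewrite expr0 mulr1 expr1n mul1r mulr_natr.
rewrite ltnS => he.
rewrite big_ord_recl expr0n mulr0 add0r.
have -> : (\sum_(y < N.+1) (-1) ^+ lift ord0 y * 'C(N.+1, lift ord0 y)%:R *
     (lift ord0 y)%:R ^+ e.+1 = - N.+1%:R *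
     \sum_(j < e.+1) 'C(e, j)%:R * (\sum_(y < N.+1) (-1) ^+ y * 'C(N, y)%:R * y%:R ^+ j)
   :> rat)%R.
  under [in RHS]eq_bigr => j _ do rewrite mulr_sumr.
  rewrite exchange_big mulr_sumr; apply: eq_bigr => y _ /=.
  rewrite /bump /= add1n exprS.
  have hb : ('C(N.+1, y.+1)%:R * y.+1%:R = N.+1%:R * 'C(N, y)%:R :> rat)%R.
    by rewrite -!natrM mulnC -mul_bin_diag.
  have hp : (y.+1%:R ^+ e = \sum_(j < e.+1) 'C(e, j)%:R * y%:R ^+ j :> rat)%R.
    rewrite -addn1 natrD addrC exprDn; apply: eq_bigr => j _.
    by rewrite expr1n mul1r mulr_natl.
  rewrite [(y.+1%:R ^+ e.+1)%R]exprS.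
  rewrite [LHS](_ : _ = - (-1) ^+ y * ('C(N.+1, y.+1)%:R * y.+1%:R) *
    y.+1%:R ^+ e)%R; last by ring.
  rewrite hb hp !mulr_sumr; apply: eq_bigr => j _; ring.
rewrite big1 ?mulr0 // => j _; rewrite IH ?mulr0 //.
by apply: leq_ltn_trans he; rewrite -ltnS.
Qed.

(** * Interpolation and running time *)

Lemma at_offsetE n (F : 'I_n -> 'I_n -> rat) (i j : 'I_n) : at_offset F (i * n + j) = F i j.
Proof.
have n0 : 0 < n by apply: leq_trans (ltn_ord i).
rewrite /at_offset divnMDl // divn_small // addn0 modnMDl modn_small //.
by rewrite !valK.
Qed.

(** Built from [at_offset], so that its rational value is the input word verbatim, out-of-range
    zeros included. *)
Definition flat n (F : 'I_n -> 'I_n -> nat) (k : nat) : nat :=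
  addr (at_offset (fun i j => ((F i j)%:R)%R) k).

Lemma flatE n (F : 'I_n -> 'I_n -> nat) (i j : 'I_n) : flat F (i * n + j) = F i j.
Proof. by rewrite /flat at_offsetE addr_nat. Qed.

Lemma natr_flat n (F : 'I_n -> 'I_n -> nat) k :
  ((flat F k)%:R)%R = at_offset (fun i j => ((F i j)%:R)%R) k.
Proof.
rewrite /flat /at_offset; case: insub => [i|] //; case: insub => [j|] //.
by rewrite addr_nat.
Qed.

(** Solving the vanishing finite difference for its term at 0: the weights evaluate any polynomial
    of degree below [N] at 0. *)
Lemma coef_sum N e : e < N ->
  (\sum_(y < N) coef N y * (y.+1)%:R ^+ e = (e == 0%N)%:R)%R.
Proof.
move=> /finite_difference_exp; rewrite big_ord_recl expr0n bin0 expr0 !mul1r.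
move/eqP; rewrite addr_eq0 => /eqP->; rewrite -sumrN; apply: eq_bigr => y _.
by rewrite /coef /bump /= exprS !mulNr mul1r opprK.
Qed.

(** * Correctness of the interpolated value *)

Section Dependency.
Variables (n M : nat) (w D L : 'I_n -> 'I_n -> nat).
Hypothesis hw : weighted_graph M w.
Hypothesis hD : forall i j, is_dist w i j (D i j).
Hypothesis hL : forall i j, L i j = lambda w D i j.
Let d := flat D.
Let l := flat L.
Let mx := maxd d (n * n).

Lemma w_sym i j : w i j = w j i. Proof. by case: hw. Qed.

Lemma offset_lt (i j : 'I_n) : i * n + j < n * n.
Proof. by have := ltn_ord i; have := ltn_ord j; nia. Qed.

Lemma maxd_leq_diam : mx <= diam D.
Proof.
apply/bigmax_leqP => -[k hk] _ /=; rewrite /d.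
have n0 : 0 < n by case: n hk.
have hi : k %/ n < n by rewrite ltn_divLR.
have hj : k %% n < n by rewrite ltn_mod.
rewrite [k in flat D k](divn_eq k n).
by rewrite (flatE D (Ordinal hi) (Ordinal hj)) leq_diam.
Qed.

Lemma dist_leq_maxd (i j : 'I_n) : D i j <= mx.
Proof.
rewrite -(flatE D i j).
exact: (@leq_bigmax _ (fun k : 'I_(n * n) => d k) (Ordinal (offset_lt i j))).
Qed.

(** For fixed [t] the summand is a constant times a power of the point, with exponent
    [D i j + D t j - D i t]. Evaluation at 0 keeps it only if this exponent is 0, that is, if [j]
    lies on a shortest path from [i] to [t]. *)
Lemma point_sum (i j t : 'I_n) :
  (\sum_(y < mx + mx + 1) coef (mx + mx + 1) y *
     ((pw d l y.+1 (i * n + j))%:R *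
      (((pw d l y.+1 (i * n + t))%:R)^-1 * (pw d l y.+1 (t * n + j))%:R))
   = (lambda_through w D i t j)%:R / (lambda w D i t)%:R :> rat)%R.
Proof.
have hs a b : D a b = D b a := dist_sym w_sym hD a b.
have hls a b : L a b = L b a by rewrite !hL (lambda_sym w_sym hD).
have tri : D i t <= D i j + D t j by rewrite (hs t); exact: (dist_triangle hD).
have hL0 : ((L i t)%:R != 0 :> rat)%R.
  by rewrite pnatr_eq0 hL -lt0n (lambda_gt0 hD).
rewrite (lambda_through_mul hD) -!hL.
transitivity ((L i j)%:R * (L j t)%:R / (L i t)%:R *
  \sum_(y < mx + mx + 1) coef (mx + mx + 1) y * y.+1%:R ^+ (D i j + D t j - D i t))%R.
  rewrite mulr_sumr; apply: eq_bigr => y _.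
  rewrite /pw /d /l !flatE !natrM !natrX (hls t).
  have hy : (y.+1%:R ^+ D i t != 0 :> rat)%R by rewrite expf_neq0 // pnatr_eq0.
  have -> : (y.+1%:R ^+ (D i j + D t j - D i t) =
      y.+1%:R ^+ D i j * y.+1%:R ^+ D t j / y.+1%:R ^+ D i t :> rat)%R.
    apply: (canRL (mulfK hy)); rewrite -!exprD; congr (_ ^+ _)%R; lia.
  by field; rewrite hy hL0.
(* The exponent is at most [2 mx], which explains the [2 mx + 1] points. *)
rewrite coef_sum; last first.
  by have := dist_leq_maxd i j; have := dist_leq_maxd t j; lia.
rewrite (hs t) subn_eq0 (_ : (_ <= D i t) = (D i j + D j t == D i t)); last first.
  by move: tri; rewrite (hs t); lia.
case: eqP => _; rewrite ?mulr1 ?mulr0 ?mul0r // natrM; by rewrite mulrAC.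
Qed.

Lemma acc_value_dependency (i j : 'I_n) :
  acc_value n d l (mx + mx + 1) (i * n + j) = dependency w D i j.
Proof.
rewrite /acc_value -/mx.
under eq_bigr => y _ do rewrite /mx_flat at_offsetE mxE mulr_sumr mulr_sumr.
rewrite exchange_big /=.
under eq_bigr => t _.
  under eq_bigr => y _ do rewrite !mxE.
  rewrite point_sum; over.
have lt0 t : ((lambda w D i t)%:R != 0 :> rat)%R.
  by rewrite pnatr_eq0 -lt0n (lambda_gt0 hD).
have hjj : lambda_through w D i j j = lambda w D i j.
  rewrite /lambda_through /lambda; apply/eqP; rewrite -all_count; apply/allP => p.
  rewrite (mem_shortest hD) => /andP[/andP[_ /eqP hp] _].
  by rewrite -[in X in X \in _]hp mem_last.
(* The term [t = j] equals 1 and cancels the initial -1. *)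
rewrite (bigD1 j) //= hjj divff // addrC addrK /dependency.
have [->|hij] := eqVneq i j; first by apply: eq_bigl => t; rewrite andbb.
(* For [i] different from [j] the term [t = i] is 0, as a detour through [j] is longer than
   [D i i = 0]. *)
rewrite (bigD1 i) //= (lambda_through_mul hD) (distxx hD) ifN; last first.
  by have := dist_gt0 hD hij; lia.
by rewrite mul0r add0r; apply: eq_bigl => t; rewrite andbC.
Qed.

End Dependency.

(** * Lower bound for matrix multiplication *)

Lemma step_writes P pc m pc' m' : step P (pc, m) = Some (pc', m') ->
  exists r, forall x, x != r -> m x = m' x.
Proof.
rewrite /step; case: ifP => // _.
by case: nth => [r ?|r ? ?|r ? ?|r ? ?|r ? ?|r ?|a ?|? ? ?|?] [_ <-];
  first [exists r; by move=> x hx; rewrite /upd (negbTE hx) |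
         exists (addr (m a)); by move=> x hx; rewrite /upd (negbTE hx) | exists 0].
Qed.

Lemma run_writes P t pc m pc' m' s : uniq s -> run P t (pc, m) = Some (pc', m') ->
  count (fun x => m x != m' x) s <= t.
Proof.
move=> hs; elim: t pc m => [|t IH] pc m.
  by case=> _ ->; rewrite (eq_count (a2 := pred0)) ?count_pred0 // => x; rewrite eqxx.
rewrite [run _ _ _]/= -/(step P (pc, m)).
case e : (step P (pc, m)) => [[pc1 m1]|] // hr.
have [r hr1] := step_writes e; have h1 := IH _ _ hr.
have h2 : count (pred1 r) s <= 1 by rewrite count_uniq_mem // leq_b1.
apply: leq_trans (_ : count (pred1 r) s + count (fun x => m1 x != m' x) s <= _).
  rewrite -count_predUI; apply: leq_trans (leq_addr _ _).
  by apply: sub_count => x /=; case: (eqVneq x r) => //= hx; rewrite (hr1 _ hx).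
by rewrite -add1n leq_add.
Qed.

(* A step writes at most one register, while the product of two all-one matrices
   differs from the input in every output register. *)
Lemma matmul_time_lower_bound Q t m' n : 1 < n ->
  halts_in Q (mm_input (const_mx 1 : 'M[rat]_n) (const_mx 1 : 'M[rat]_n))%R t m' ->
  (forall i j : 'I_n, m' (1 + i * n + j)%N =
     ((const_mx 1 : 'M[rat]_n) *m (const_mx 1 : 'M[rat]_n))%R i j) ->
  n * n <= t.
Proof.
move=> hn [pc [hr _]] ho.
have := run_writes (iota_uniq 1 (n * n)) hr.
suff /eqP -> : count (fun x => mm_input (const_mx 1 : 'M[rat]_n) (const_mx 1 : 'M[rat]_n) x
    != m' x)%R (iota 1 (n * n)) == size (iota 1 (n * n)) by rewrite size_iota.
rewrite -all_count; apply/allP => x; rewrite mem_iota => /andP[x0 hx].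
have n0 : 0 < n by lia.
have hk : x - 1 < n * n by lia.
rewrite /mm_input ifN; last by lia.
rewrite hk (@at_offset_flat _ _ (fun=> 1%R)) //; last by move=> i j; rewrite mxE.
have hi : (x - 1) %/ n < n by rewrite ltn_divLR.
have hj : (x - 1) %% n < n by rewrite ltn_mod.
have -> : x = 1 + Ordinal hi * n + Ordinal hj by rewrite /= -addnA -divn_eq; lia.
rewrite ho mxE; under eq_bigr => k _ do rewrite !mxE mulr1.
by rewrite sumr_const card_ord -[1%R]/(1%:R)%R eqr_nat; lia.
Qed.

(** If [tau] were negative, [n^tau <= 1] would give [n^2 <= 2 c] for all [n > 1]. So [n^tau >= 1],
    and the additive 1 in the time bound is absorbed by doubling the constant. *)
Lemma matmul_exponent_bound (tau c : Rdefinitions.R) Q : (0 < c)%R ->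
  (forall n (A B : 'M[rat]_n), exists t m',
      [/\ halts_in Q (mm_input A B) t m',
          forall i j : 'I_n, m' (1 + i * n + j)%N = ((A *m B)%R) i j &
          (t%:R <= c * ((n%:R `^ tau) + 1))%R]) ->
  forall n, 1 < n ->
    (1 <= (n%:R : Rdefinitions.R) `^ tau)%R /\ ((n * n)%:R <= 2 * c * n%:R `^ tau)%R.
Proof.
move=> c0 hQ.
have lower n : 1 < n -> ((n * n)%:R <= c * (n%:R `^ tau + 1))%R.
  move=> hn; have [t [m' [hh ho ht]]] := hQ n (const_mx 1)%R (const_mx 1)%R.
  apply: le_trans ht; rewrite ler_nat.
  exact: matmul_time_lower_bound hn hh ho.
have tau0 : (0 <= tau)%R.
  rewrite leNgt; apply/negP => htau.
  pose n := (Num.truncn (2 * c)).+2.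
  have h1 : (n%:R `^ tau <= 1 :> Rdefinitions.R)%R.
    rewrite -[X in (_ <= X)%R](powRr0 (n%:R)); apply: ler_powR; [by rewrite ler1n | exact: ltW].
  have h2 := lower n isT.
  have h3 : (n%:R <= (n * n)%:R :> Rdefinitions.R)%R by rewrite ler_nat leq_pmulr.
  have h4 : (2 * c < (Num.truncn (2 * c)).+1%:R)%R.
    by apply: truncnS_gt.
  have h5 : ((Num.truncn (2 * c)).+1%:R <= n%:R :> Rdefinitions.R)%R by rewrite ler_nat.
  have h6 : (c * (n%:R `^ tau + 1) <= c * 2)%R.
    by rewrite ler_pM2l // -[2%R]/(1 + 1)%R lerD2r.
  by have := le_trans (le_trans h5 h3) (le_trans h2 h6); rewrite leNgt mulrC h4.
move=> n hn; have h1 : (1 <= (n%:R : Rdefinitions.R) `^ tau)%R.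
  rewrite -[X in (X <= _)%R](powRr0 (n%:R)); apply: ler_powR => //; rewrite ler1n; lia.
split=> //; apply: le_trans (lower n hn) _.
rewrite [(2 * c)%R]mulrC -mulrA ler_pM2l // mulr2n mulrDl mul1r lerD2l //.
Qed.

Definition dependency_program (Q : program) : program :=
  compile 0 (Seq prologue (Seq (compute Q) epilogue)).

(** The sum of the three phases: [52 = 12 + 34 + 6] per matrix position and [346 = 46 + 200 + 100].
    Here [k] bounds the largest distance and [K] is the cost factor of one simulated step. *)
Definition running_time (n k K tq : nat) : nat :=
  n * n * 52 + n * 24 + 346 + (k + k + 1) * (k * 32 + n * n * 250 + tq * K + 202).

Lemma dependency_program_correct Q n M (w D L : 'I_n -> 'I_n -> nat) tq :
  (forall A B : 'M[rat]_n, exists t m', [/\ halts_in Q (mm_input A B) t m',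
     forall i j : 'I_n, m' (1 + i * n + j)%N = (A *m B)%R i j & (t <= tq)%N]) ->
  weighted_graph M w -> (forall i j, is_dist w i j (D i j)) ->
  (forall i j, L i j = lambda w D i j) ->
  exists t m', [/\ halts_in (dependency_program Q) (dep_input M D L) t m',
    forall i j : 'I_n, m' (2 + i * n + j)%N = dependency w D i j &
    t <= running_time n (diam D) (7 * size Q + 100) tq].
Proof.
move=> hQ hw hD hL.
have inp0 : dep_input M D L 0 = (n%:R)%R by [].
have inp_out x : n * n + n * n + 2 <= x -> dep_input M D L x = 0%R.
  by move=> hx; rewrite /dep_input !ifN //; lia.
have inpD k : k < n * n -> dep_input M D L (2 + k) = ((flat D k)%:R)%R.
  by move=> hk; rewrite /dep_input /= addKn hk natr_flat.
have inpL k : k < n * n -> dep_input M D L (2 + (n * n + k)) = ((flat L k)%:R)%R.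
  move=> hk; rewrite /dep_input /= addKn ifN; last by lia.
  by rewrite addKn hk natr_flat.
have d0 : flat D 0 = 0.
  case: n D {w L tq hQ hw hD hL inp0 inp_out inpD inpL} (distxx hD) => [|n'] D hxx //.
    rewrite /flat /at_offset; case: insub => [[]|] //.
  by rewrite -[0]/((ord0 : 'I_n'.+1) * n'.+1 + (ord0 : 'I_n'.+1)) flatE hxx.
set mx := maxd (flat D) (n * n).
set Tc := n * n * 34 + n * 24 + 200 + (mx + mx + 1) *
  (mx * 32 + n * n * 250 + tq * (7 * size Q + 100) + 202).
suff h : wp (Seq prologue (Seq (compute Q) epilogue))
    (42 + (n * n * 12 + 4) + (Tc + (100 + n * n * 6)))
    (fun m' => forall i j : 'I_n, m' (2 + i * n + j) = dependency w D i j) (dep_input M D L).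
  have [t [m' [hh ht ho]]] := wp_halts h; exists t, m'; split=> //.
  apply: leq_trans ht _; rewrite /running_time.
  have hmx : mx <= diam D := maxd_leq_diam D.
  have : (mx + mx + 1) * (mx * 32 + n * n * 250 + tq * (7 * size Q + 100) + 202) <=
    (diam D + diam D + 1) * (diam D * 32 + n * n * 250 + tq * (7 * size Q + 100) + 202).
    by apply: leq_mul; rewrite ?leq_add2r ?leq_add // leq_mul2r hmx.
  by rewrite /Tc; lia.
apply: wp_seq; apply: wp_weaken (prologue_wp inp0 inp_out (fun=> erefl)) => // m1.
move=> [g0 ga gx].
apply: wp_seq.
have hc : hwp (compute Q) Tc (fun s' => std7 n (rg s') /\ forall k, k < n * n ->
    ar s' (base_acc (n * n) + k) = acc_value n (flat D) (flat L) (mx + mx + 1) k) (view m1).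
  apply: compute_wp => //.
  - move=> k hk k0; rewrite -inpD // -ga; last by lia.
    by congr (ar _ _); bases.
  - move=> k hk; rewrite -inpL // -ga; last by lia.
    by congr (ar _ _); bases.
apply: wp_weaken (hc m1 erefl) => // m2 [[e0 e1 e2 [e3 e4 e5 e6]] hacc].
apply: wp_weaken (epilogue_wp e1 e4 e6 hacc) => // m3 h3 i j.
rewrite -(acc_value_dependency hw hD hL) -/mx -h3; last exact: offset_lt.
by congr m3; lia.
Qed.

Lemma diam_small n (D : 'I_n -> 'I_n -> nat) : n <= 1 -> (forall i, D i i = 0) ->
  diam D = 0.
Proof.
move=> hn hxx; apply/eqP; rewrite -leqn0; apply/bigmax_leqP => i _.
apply/bigmax_leqP => j _; have -> : i = j; last by rewrite hxx.
by apply: ord_inj; have := ltn_ord i; have := ltn_ord j; lia.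
Qed.

Lemma running_time_small n K tq : n <= 1 -> running_time n 0 K tq <= 874 + K * tq.
Proof.
rewrite /running_time [K * _]mulnC; move: (tq * K) => X.
by case: n => [|[|//]] _; lia.
Qed.

Lemma running_time_bound (R : realType) (c x : R) (n M k K tq : nat) : (0 < c)%R ->
  1 < n -> 0 < k -> k <= M * n -> ((n * n)%:R <= 2 * c * x)%R -> (1 <= x)%R ->
  (tq%:R <= c * (x + 1))%R ->
  ((running_time n k K tq)%:R <= 2 * c * (1874 + 3 * K%:R) * (M%:R * x * k%:R))%R.
Proof.
move=> c0 hn hk hkM hnn hx htq.
have hM : 0 < M by case: M hkM => //; rewrite mul0n; lia.
(* Each round contributes [484 = 32 + 250 + 202] and there are at most [3 k] rounds;
   [1874 = 3 * 484 + (52 + 24 + 346)]. *)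
have : running_time n k K tq <= M * k * (1874 * (n * n) + 3 * K * tq).
  rewrite /running_time.
  have h1 : n <= n * n by rewrite leq_pmulr; lia.
  have h2 : k <= M * (n * n) by apply: leq_trans hkM _; rewrite leq_mul2l h1 orbT.
  have h3 : (k + k + 1) * (k * 32 + n * n * 250 + tq * K + 202) <=
      3 * k * (M * (484 * (n * n) + K * tq)).
    apply: leq_mul; first by lia.
    have : n * n <= M * (n * n) by rewrite leq_pmull.
    have : K * tq <= M * (K * tq) by rewrite leq_pmull.
    by rewrite mulnDr [tq * K]mulnC; lia.
  have h4 : n * n <= M * k * (n * n) by rewrite leq_pmull // muln_gt0 hM hk.
  apply: leq_trans (leq_add (leqnn _) h3) _.
  have h5 : 3 * k * (M * (484 * (n * n) + K * tq)) =
    1452 * (M * k * (n * n)) + 3 * (M * k * (K * tq)) by ring.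
  have h6 : M * k * (1874 * (n * n) + 3 * K * tq) =
    1874 * (M * k * (n * n)) + 3 * (M * k * (K * tq)) by ring.
  by rewrite h5 h6; lia.
rewrite -(ler_nat R) => /le_trans; apply.
rewrite natrM natrM [leRHS](_ : _ = M%:R * k%:R * (2 * c * (1874 + 3 * K%:R) * x))%R; last by ring.
apply: ler_wpM2l; first by rewrite mulr_ge0.
rewrite natrD !natrM in hnn *.
have h1 : (tq%:R <= 2 * c * x)%R.
  apply: le_trans htq _; rewrite [(2 * c)%R]mulrC -mulrA ler_pM2l //.
  by lra.
have h2 : (3 * K%:R * tq%:R <= 3 * K%:R * (2 * c * x))%R.
  by apply: ler_wpM2l => //; rewrite mulr_ge0.
have h3 : (1874 * (n%:R * n%:R) <= 1874 * (2 * c * x) :> R)%R by rewrite ler_pM2l.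
apply: le_trans (lerD h3 h2) _.
by rewrite le_eqVlt; apply/orP; left; apply/eqP; ring.
Qed.

Theorem theorem3p10 (tau : Rdefinitions.R) :
  matmul_in_time tau ->
  exists (C : Rdefinitions.R) (P : program), (0 < C)%R /\
    forall (n M : nat) (w : 'I_n -> 'I_n -> nat) (D L : 'I_n -> 'I_n -> nat),
      weighted_graph M w ->
      (forall i j, is_dist w i j (D i j)) ->
      (forall i j, L i j = lambda w D i j) ->
      exists t m',
        [/\ halts_in P (dep_input M D L) t m',
            forall i j : 'I_n, m' (2 + i * n + j)%N = dependency w D i j &
            (t%:R <= C * (M%:R * (n%:R `^ tau) * (diam D)%:R + 1))%R].
Proof.
move=> [c [Q [c0 hQ]]].
set K := 7 * size Q + 100.
(* The first summand serves [n > 1]. For [n <= 1] the diameter is 0 and only the additive 1 of the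
   bound remains, so the second summand pays for the whole run, with [tq <= 2 c]. *)
pose C : Rdefinitions.R := (2 * c * (1874 + 3 * K%:R) + (874 + 2 * c * K%:R))%R.
have K0 : (0 <= K%:R :> Rdefinitions.R)%R by [].
have C1 : (0 <= 2 * c * (1874 + 3 * K%:R))%R.
  apply: mulr_ge0 (mulr_ge0 (ler0n _ 2) (ltW c0)) _.
  exact: addr_ge0 (ler0n _ 1874) (mulr_ge0 (ler0n _ 3) K0).
have C2 : (0 < 874 + 2 * c * K%:R)%R.
  by apply: ltr_pwDl; [rewrite ltr0n | rewrite !mulr_ge0 // ltW].
exists C, (dependency_program Q); split; first by rewrite ltr_wpDl.
move=> n M w D L hw hD hL.
set x := (n%:R `^ tau)%R.
have x0 : (0 <= x)%R by exact: powR_ge0.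
have b0 : (0 <= c * (x + 1))%R by rewrite mulr_ge0 ?addr_ge0 // ltW.
pose tq := Num.truncn (c * (x + 1))%R.
have htq : (tq%:R <= c * (x + 1))%R by rewrite /tq truncn_le.
have hQ' (A B : 'M[rat]_n) : exists t m', [/\ halts_in Q (mm_input A B) t m',
     forall i j : 'I_n, m' (1 + i * n + j)%N = (A *m B)%R i j & (t <= tq)%N].
  have [t [m' [h1 h2 h3]]] := hQ n A B; exists t, m'; split=> //.
  by rewrite /tq truncn_ge_nat.
have [t [m' [h1 h2 h3]]] := dependency_program_correct hQ' hw hD hL.
exists t, m'; split=> //.
apply: (@le_trans _ _ ((running_time n (diam D) K tq)%:R)%R); first by rewrite ler_nat.
have z0 : (0 <= M%:R * x * (diam D)%:R)%R by rewrite !mulr_ge0.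
have [hn|hn] := ltnP 1 n.
  have [x1 hnn] := matmul_exponent_bound c0 hQ hn.
  apply: le_trans (running_time_bound K c0 hn (diam_gt0 hw hD hn) (diam_bound hw hD) hnn x1 htq) _.
  rewrite /C -[leLHS]addr0 [leRHS]mulrDl; apply: lerD.
    by apply: ler_wpM2l => //; rewrite lerDl.
  by apply: mulr_ge0; [exact: ltW | exact: addr_ge0].
have diam0 : diam D = 0 := diam_small hn (distxx hD).
have x1 : (x <= 1)%R.
  move: hn; rewrite /x; case: (n) => [|[|//]] _; last by rewrite powR1.
  have [->|t0] := eqVneq tau 0%R; first by rewrite powRr0.
  by rewrite powR0.
rewrite diam0 mulr0 add0r mulr1 /C; apply: ler_wpDl => //.
have := running_time_small K tq hn; rewrite -(ler_nat Rdefinitions.R) => /le_trans; apply.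
rewrite natrD natrM lerD2l mulrC; apply: ler_wpM2r => //.
apply: le_trans htq _; rewrite [(2 * c)%R]mulrC; apply: ler_wpM2l; first exact: ltW.
by rewrite -[2%R]/(1 + 1)%R lerD2r.
Qed.
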